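(* Let $\mu$ be a nonzero finite Borel measure on $\mathbb{R}^d$, $\mathcal{E}=\mathcal{E}_\mu$ the exponential family based on $\mu$ and $\operatorname{ext}(\mathcal{E})$ its extension. If a sequence $Q_n$ in $\operatorname{ext}(\mathcal{E})$ converges in variation distance to a probability measure $P$, then $P$ belongs to a component $\mathcal{E}^F$ of $\operatorname{ext}(\mathcal{E})$ (with $F$ a face of $\operatorname{cc}(\mu)$); for all sufficiently large $n$ the face $F_n$ of $\operatorname{cc}(\mu)$ with $Q_n\in\mathcal{E}^{F_n}$ contains $F$, and the conditioned probability measures $Q_n(\cdot\mid\operatorname{cl}(F))$ belong to $\mathcal{E}^F$ and also converge to $P$ in variation distance.
   Context: For nonempty $B\subseteq\mathbb{R}^d$, $\operatorname{lin}(B)$ is the linear subspace obtained by shifting the affine hull of $B$ to contain the origin; $\operatorname{cl}$ is closure. A face of a nonempty convex set $C$ is a nonempty convex subset $F\subseteq C$ such that $tx+(1-t)y\in F$ with $x,y\in C$, $0<t<1$ implies $x,y\in F$ ($F=C$ allowed). The convex support $\operatorname{cs}(\mu)$, resp. convex core $\operatorname{cc}(\mu)$, is the intersection of all closed convex sets, resp. all convex Borel sets, $C\subseteq\mathbb{R}^d$ with $\mu(C)=\mu(\mathbb{R}^d)$; $\operatorname{lin}(\mu)=\operatorname{lin}(\operatorname{cs}(\mu))$. $\mathcal{E}=\mathcal{E}_\mu=\{Q_\vartheta:\vartheta\in\operatorname{dom}(\Lambda)\cap\operatorname{lin}(\mu)\}$, where $\Lambda(\vartheta)=\ln\int_{\mathbb{R}^d}e^{\langle\vartheta,x\rangle}\mu(dx)$,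 $\operatorname{dom}(\Lambda)=\{\Lambda<\infty\}$, and $Q_\vartheta$ is the probability measure with $\mu$-density $e^{\langle\vartheta,x\rangle-\Lambda(\vartheta)}$. For a face $F$ of $\operatorname{cc}(\mu)$ (for which $\mu(\operatorname{cl}(F))>0$), $\Lambda_F(\vartheta)=\ln\int_{\operatorname{cl}(F)}e^{\langle\vartheta,x\rangle}\mu(dx)$, $\operatorname{dom}(\Lambda_F)=\{\Lambda_F<\infty\}$, $\Theta_F=\operatorname{dom}(\Lambda_F)\cap\operatorname{lin}(F)$, $Q_{F,\theta}$ is the probability measure with density $e^{\langle\theta,x\rangle-\Lambda_F(\theta)}$ with respect to the restriction of $\mu$ to $\operatorname{cl}(F)$, and $\mathcal{E}^F=\{Q_{F,\theta}:\theta\in\Theta_F\}$. The extension $\operatorname{ext}(\mathcal{E})$ is the union of the families $\mathcal{E}^F$, called its components, over all faces $F$ of $\operatorname{cc}(\mu)$. $Q(\cdot\mid B)$ denotes the restriction of $Q$ to $B$ divided by $Q(B)$. Convergence in variation distance means total variation $|Q_n-P|\to0$. *)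

(* Defs.v *)
From HB Require Import structures.
From mathcomp Require Import all_boot all_order all_algebra.
From mathcomp Require Import all_classical all_reals all_analysis.

Set Implicit Arguments.
Unset Strict Implicit.
Unset Printing Implicit Defensive.

Import Order.TTheory GRing.Theory Num.Theory.
Import numFieldNormedType.Exports.

Local Open Scope classical_set_scope.
Local Open Scope ring_scope.

(* Matrices over a realType carry their Borel sigma-algebra, so that 'rV[R]_d
   is the Borel space R^d. *)
HB.instance Definition _ (R : realType) (m n : nat) :=
  @isMeasurable.Build (sigma_display (@open 'M[R]_(m, n))) 'M[R]_(m, n)
    <<s @open 'M[R]_(m, n) >> (@sigma_algebra0 _ setT (@open 'M[R]_(m, n)))
    (@sigma_algebraC _ (@open 'M[R]_(m, n)))
    (@sigma_algebra_bigcup _ setT (@open 'M[R]_(m, n))).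

Lemma measurable_closure_mx (R : realType) (m n : nat)
  (B : set 'M[R]_(m, n)) : measurable (closure B).
Proof.
rewrite -[closure B]setCK; apply: measurableC.
by apply: sub_sigma_algebra; exact/closed_openC/closed_closure.
Qed.

Section convex_geometry.
Context (R : realType) (d : nat).
Implicit Types (A B C F : set 'rV[R]_d).

Definition affine_set A : Prop :=
  forall (t : R) x y, A x -> A y -> A (t *: x + (1 - t) *: y).

Definition affine_hull B : set 'rV[R]_d := smallest affine_set B.

(* All translates of the affine hull that contain the origin coincide, so their
   union is the linear subspace parallel to the affine hull. *)
Definition lin B : set 'rV[R]_d :=
  [set x - b | x in affine_hull B & b in affine_hull B].

Definition is_face C F : Prop :=
  [/\ F !=set0, convex_set F, F `<=` C &
      forall (t : R) x y, C x -> C y -> 0 < t < 1 ->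
        F (t *: x + (1 - t) *: y) -> F x /\ F y].

End convex_geometry.

Section total_variation.
Context d (T : measurableType d) (R : realType).
Local Open Scope ereal_scope.

(* Total mass of the variation of nu; it does not depend on the Hahn
   decomposition that is chosen (Hahn_decomposition_uniq). *)
Definition total_variation_charge (nu : charge T R) : \bar R :=
  charge_variation (svalP (cid (svalP (cid (Hahn_decomposition nu))))) [set: T].

Definition variation_dist (Q P : probability T R) : \bar R :=
  total_variation_charge
    (cadd (charge_of_finite_measure Q) (copp (charge_of_finite_measure P))).

Definition cvg_in_variation (Q : nat -> probability T R)
    (P : probability T R) : Prop :=
  variation_dist (Q n) P @[n --> \oo] --> 0.

(* The conditioned measure Q(. | B); when Q B = 0, where conditioning is
   undefined, it is the arbitrary probability measure point. *)
Definition conditioned (Q : probability T R) (B : set T) (mB : measurable B) :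
    probability T R :=
  mnormalize (mrestr Q mB) point.

End total_variation.

Section exponential_family.
Context (R : realType) (d : nat).
Implicit Types (mu : {finite_measure set 'rV[R]_d -> \bar R}).
Implicit Types (A C F L : set 'rV[R]_d) (theta x : 'rV[R]_d).
Implicit Types (Q : probability 'rV[R]_d R).

Definition dotv (u v : 'rV[R]_d) : R := \sum_(i < d) u ord0 i * v ord0 i.

Definition convex_support mu : set 'rV[R]_d :=
  \bigcap_(C in [set C : set 'rV[R]_d |
    [/\ closed C, convex_set C & mu C = mu setT]]) C.

Definition convex_core mu : set 'rV[R]_d :=
  \bigcap_(C in [set C : set 'rV[R]_d |
    [/\ measurable C, convex_set C & mu C = mu setT]]) C.

(* The functions below concern the restriction of mu to A; the set A is the
   whole space for the family based on mu, and cl(F) for a component. *)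
Definition log_laplace mu A theta : \bar R :=
  lne (\int[mu]_(x in A) (expR (dotv theta x))%:E).

Definition dom_log_laplace mu A : set 'rV[R]_d :=
  [set theta | (log_laplace mu A theta < +oo)%E].

(* Q is the probability measure with density
   exp(<theta, x> - Lambda_A(theta)) with respect to the restriction. This
   forces mu A > 0, so fine only removes the injection into \bar R. *)
Definition is_tilted mu A theta Q : Prop :=
  forall B, measurable B ->
    Q B = (\int[mu]_(x in B `&` A)
             (expR (dotv theta x - fine (log_laplace mu A theta)))%:E)%E.

Definition tilted_family mu A L : set (probability 'rV[R]_d R) :=
  [set Q | exists2 theta,
    (dom_log_laplace mu A `&` L) theta & is_tilted mu A theta Q].

Definition exp_family mu : set (probability 'rV[R]_d R) :=
  tilted_family mu setT (lin (convex_support mu)).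

Definition component mu F : set (probability 'rV[R]_d R) :=
  tilted_family mu (closure F) (lin F).

Definition extension mu : set (probability 'rV[R]_d R) :=
  \bigcup_(F in is_face (convex_core mu)) component mu F.

End exponential_family.

(* Main.v *)
(* On the closure of a face F_n the log-density of Q_n is affine. Separating F_n
   from cc(mu) \ F_n by functionals that diverge off the affine hull of F_n shows
   that this density is a limit in mu-measure of exponentials of affine functions
   on the whole space. Hence the density f of P is the mu-a.e. limit of exp(a_k)
   for affine functions a_k. Let A be the smallest affine set with P(A) = 1. The
   set where (a_k) converges in R is affine and has full P-measure, so it contains
   A, and off A a_k tends to -oo mu-a.e. Thus N = A `|` {a_k -> -oo} is a convex
   Borel set of full mu-measure: it contains cc(mu), and since a_k cannot tend to
   -oo at a point of A, F = cc(mu) `&` A is a face. On A, f = exp(lim a_k), and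
   mu(A \ cl F) = 0 because cc(mu) meets every convex Borel set of positive
   measure; so P is in the component of F. Finally, affine sets with P-measure
   close enough to 1 contain A, which applies to the affine hulls of the F_n. *)

Require Import Defs.
From HB Require Import structures.
From mathcomp Require Import all_boot all_order all_algebra.
From mathcomp Require Import all_classical all_reals all_analysis.
From mathcomp Require Import measurable_realfun ring lra.

Set Implicit Arguments.
Unset Strict Implicit.
Unset Printing Implicit Defensive.

Import Order.TTheory GRing.Theory Num.Theory.
Import numFieldNormedType.Exports.

Local Open Scope classical_set_scope.
Local Open Scope ring_scope.

(** * Affine sets and faces in R^d *)

Section dot_product.
Context (R : realType) (d : nat).
Implicit Types (u v w x : 'rV[R]_d).

Lemma dotvE u v : dotv u v = (u *m v^T) ord0 ord0.
Proof. by rewrite mxE; apply: eq_bigr => i _; rewrite !mxE. Qed.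

Lemma dotvC u v : dotv u v = dotv v u.
Proof. by apply: eq_bigr => i _; rewrite mulrC. Qed.

Lemma dotvDl u v w : dotv (u + v) w = dotv u w + dotv v w.
Proof. by rewrite !dotvE mulmxDl mxE. Qed.

Lemma dotvZl (a : R) u v : dotv (a *: u) v = a * dotv u v.
Proof. by rewrite !dotvE -scalemxAl mxE. Qed.

Lemma dotvNl u v : dotv (- u) v = - dotv u v.
Proof. by rewrite -scaleN1r dotvZl mulN1r. Qed.

Lemma dotvDr u v w : dotv u (v + w) = dotv u v + dotv u w.
Proof. by rewrite dotvC dotvDl !(dotvC u). Qed.

Lemma dotvZr (a : R) u v : dotv u (a *: v) = a * dotv u v.
Proof. by rewrite dotvC dotvZl (dotvC u). Qed.

Lemma dotvNr u v : dotv u (- v) = - dotv u v.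
Proof. by rewrite dotvC dotvNl dotvC. Qed.

Lemma dotv0 u : dotv u 0 = 0.
Proof. by rewrite -(scale0r (0 : 'rV[R]_d)) dotvZr mul0r. Qed.

Lemma dotv_ge0 u : 0 <= dotv u u.
Proof. by apply: sumr_ge0 => i _; rewrite -expr2 sqr_ge0. Qed.

Lemma dotv_eq0 u : dotv u u = 0 -> u = 0.
Proof.
move=> /eqP; rewrite psumr_eq0 => [/allP u0|i _]; last by rewrite -expr2 sqr_ge0.
apply/rowP => i; apply/eqP; rewrite mxE.
by have := u0 i (mem_index_enum i); rewrite mulf_eq0 orbb.
Qed.

Lemma dotv_delta i x : dotv (delta_mx ord0 i) x = x ord0 i.
Proof.
rewrite /dotv (bigD1 i)//= mxE !eqxx mul1r big1 ?addr0// => j ji.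
by rewrite mxE (negbTE ji) andbF mul0r.
Qed.

Lemma normr_dotv_le u v : `|dotv u v| <= (\sum_i `|u ord0 i|) * (\sum_i `|v ord0 i|).
Proof.
rewrite (le_trans (ler_norm_sum _ _ _))// mulr_suml ler_sum// => i _.
rewrite normrM ler_wpM2l// (bigD1 i)//= lerDl sumr_ge0// .
Qed.

Lemma dotv_continuous u : continuous (dotv u).
Proof.
apply: (@continuous_big R 'I_d +%R 0 xpredT _ _ (index_enum _)
  (fun i v => u ord0 i * v ord0 i)) => [|i _ x]; first by move=> x; apply: cvgD; [exact: cvg_fst|exact: cvg_snd].
by apply: (@continuous_comp _ _ _ (fun v : 'rV[R]_d => v ord0 i) ( *%R (u ord0 i))); [exact: coord_continuous|exact: mulrl_continuous].
Qed.

End dot_product.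

Section subspaces.
Context (R : realType) (d : nat).
Implicit Types (u v w x : 'rV[R]_d) (V : 'M[R]_d) (A : set 'rV[R]_d).

Lemma subspace_rowspace (S : set 'rV[R]_d) : S 0 ->
    (forall (a : R) u v, S u -> S v -> S (a *: u + v)) ->
  exists V, forall v, S v <-> (v <= V)%MS.
Proof.
move=> S0 Slin.
pose T n := `[< exists2 V : 'M[R]_d, \rank V = n & forall v, (v <= V)%MS -> S v >].
have exT : exists n, T n.
  exists 0; apply/asboolP; exists 0; first exact: mxrank0.
  by move=> v; rewrite submx0 => /eqP ->.
have Tle n : T n -> (n <= d)%N by move=> /asboolP[V <- _]; exact: rank_leq_row.
case: (ex_maxnP exT Tle) => n /asboolP[V rV VS] maxn; exists V => v; split; last exact: VS.
move=> Sv; apply/negPn/negP => nvV.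
have : (\rank (V + v)%MS <= \rank V)%N.
  rewrite rV; apply: maxn; apply/asboolP; exists (V + v)%MS => // w.
  move=> /sub_addsmxP[[a b] /= ->].
  rewrite addrC (mx11_scalar b) mul_scalar_mx; apply: Slin => //.
  by apply: VS; exact: submxMl.
rewrite leqNgt => /negP; apply; rewrite ltn_neqAle mxrankS ?addsmxSl// andbT.
apply: contra nvV => /eqP rE; have : (V == V + v)%MS by rewrite -mxrank_leqif_eq ?addsmxSl// rE.
by move=> /eqmxP e; rewrite e addsmxSr.
Qed.

Lemma orthogonal_projection V : exists p : 'M[R]_d,
  (forall v, (v *m p <= V)%MS) /\
  forall v w, (w <= V)%MS -> dotv (v *m p) w = dotv v w.
Proof.
pose U := kermx V^T.
have orth u w : (u <= U)%MS -> (w <= V)%MS -> dotv u w = 0.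
  move=> /sub_kermxP uV /submxP[w' ->].
  by rewrite dotvE trmx_mul mulmxA uV mul0mx mxE.
have dVU : (V :&: U)%MS = 0.
  apply/eqP; rewrite -submx0; apply/rV_subP => w; rewrite sub_capmx => /andP[wV wU].
  by rewrite submx0; apply/eqP/dotv_eq0; exact: orth.
have fVU : (1%:M <= V + U)%MS.
  rewrite sub1mx /row_full; have := mxrank_sum_cap V U; rewrite dVU mxrank0 addn0 => ->.
  by rewrite mxrank_ker mxrank_tr subnKC// rank_leq_row.
exists (proj_mx V U); split=> [v|v w wV]; first exact: proj_mx_sub.
have vVU : (v <= V + U)%MS by rewrite (submx_trans _ fVU)// submx1.
rewrite -[in RHS](add_proj_mx dVU vVU) dotvDl [X in _ + X]orth ?addr0//.
exact: proj_mx_sub.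
Qed.

Lemma closed_rowspace V : closed [set v : 'rV[R]_d | (v <= V)%MS].
Proof.
rewrite (_ : [set v : 'rV[R]_d | (v <= V)%MS] = \bigcap_(i in [set: 'I_d])
    [set v : 'rV[R]_d | dotv ((col i (cokermx V))^T) v = 0]).
  apply: closed_bigI => i _.
  rewrite (_ : [set v | _] = dotv ((col i (cokermx V))^T) @^-1` [set 0])//.
  by apply: closed_comp => [v _|]; [exact: dotv_continuous|exact: closed_eq].
have key v i : dotv ((col i (cokermx V))^T) v = (v *m cokermx V) ord0 i.
  by rewrite mxE; apply: eq_bigr => j _; rewrite !mxE mulrC.
apply/seteqP; split => v; rewrite /= submxE.
  by move=> /eqP v0 i _ /=; rewrite key v0 mxE.
by move=> v0; apply/eqP/rowP => i; rewrite [RHS]mxE -key; exact: v0.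
Qed.

Definition flat x V : set 'rV[R]_d := [set y | (y - x <= V)%MS].

Lemma affine_flat x V : affine_set (flat x V).
Proof.
move=> t y z yV zV; rewrite /flat/= (_ : _ - x = t *: (y - x) + (1 - t) *: (z - x)).
  by rewrite addmx_sub// scalemx_sub.
by apply/rowP => i; rewrite !mxE; ring.
Qed.

Lemma flat_refl x V : flat x V x.
Proof. by rewrite /flat/= subrr sub0mx. Qed.

Lemma flat_sub x V y z : flat x V y -> flat x V z -> (y - z <= V)%MS.
Proof.
move=> xy xz; rewrite (_ : y - z = (y - x) - (z - x)); last by rewrite opprB addrA subrK.
by rewrite addmx_sub// eqmx_opp.
Qed.

Lemma flat_addr x V v : flat x V (x + v) = (v <= V)%MS :> Prop.
Proof. by rewrite /flat/= addrAC subrr add0r. Qed.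

Lemma closed_flat x V : closed (flat x V).
Proof.
rewrite (_ : flat x V = (fun y => y - x) @^-1` [set v : 'rV[R]_d | (v <= V)%MS])//.
apply: preimage_closed; last exact: closed_rowspace.
by move=> y _; exact: (cvgB cvg_id (cvg_cst x)).
Qed.

Lemma affine_setP A x : affine_set A -> A x -> exists V, A = flat x V.
Proof.
move=> affA Ax.
have key a u v : A (x + u) -> A (x + v) -> A (x + (a *: u + v)).
  move=> Au Av.
  have sc b w : A (x + w) -> A (x + b *: w).
    move=> Aw; rewrite (_ : _ + _ = b *: (x + w) + (1 - b) *: x); first exact: affA.
    by apply/rowP => i; rewrite !mxE; ring.
  rewrite (_ : _ + _ = x + 2 *: (2^-1 *: (a *: u + v))); last by rewrite scalerA mulfV// scale1r.
  apply: (sc); rewrite (_ : _ + _ = 2^-1 *: (x + a *: u) + (1 - 2^-1) *: (x + v)).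
    by apply: affA => //; exact: sc.
  by apply/rowP => i; rewrite !mxE; field.
have [|V VP] := @subspace_rowspace [set v | A (x + v)] _ key; first by rewrite /= addr0.
exists V; apply/seteqP; split=> y; rewrite /flat/=.
  by move=> Ay; apply/VP; rewrite /= addrC subrK.
by move=> /VP/=; rewrite addrC subrK.
Qed.

Lemma closed_affine A : affine_set A -> closed A.
Proof.
move=> affA; have [->|/set0P[x Ax]] := eqVneq A set0; first exact: closed0.
by have [V ->] := affine_setP affA Ax; exact: closed_flat.
Qed.

Lemma affine_convex A : affine_set A -> convex_set A.
Proof. by move=> affA x y l; rewrite !inE => Ax Ay; exact: affA. Qed.

Lemma affine_setI A (B : set 'rV[R]_d) : affine_set A -> affine_set B -> affine_set (A `&` B).
Proof. by move=> hA hB t x y [? ?] [? ?]; split; [exact: hA|exact: hB]. Qed.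

Lemma affine_affine_hull A : affine_set (affine_hull A).
Proof.
by move=> t x y hx hy B BA; have [+ _] := BA; apply; [exact: hx|exact: hy].
Qed.

Lemma sub_affine_hull A : A `<=` affine_hull A.
Proof. exact: sub_smallest. Qed.

Lemma affine_hull_sub A (B : set 'rV[R]_d) : affine_set B -> A `<=` B -> affine_hull A `<=` B.
Proof. exact: smallest_sub. Qed.

Lemma lin_flat A x V : affine_hull A = flat x V -> lin A = [set v | (v <= V)%MS].
Proof.
move=> hA; rewrite /lin hA; apply/seteqP; split => v /=.
  by move=> [y yV [z zV] <-]; exact: flat_sub yV zV.
move=> vV; exists (x + v); first by rewrite flat_addr.
by exists x; [exact: flat_refl|rewrite addrAC subrr add0r].
Qed.

Lemma convex_setP (K : set 'rV[R]_d) : convex_set K <->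
  forall (t : R) x y, K x -> K y -> 0 < t < 1 -> K (t *: x + (1 - t) *: y).
Proof.
split=> [cK t x y Kx Ky /andP[t0 t1]|cK].
  have [t0' t1'] := (ltW t0, ltW t1).
  have ti : Itv.spec (@Itv.num_sem R) (Itv.Real `[0%Z, 1%Z]) t.
    by rewrite /Itv.num_sem/= in_itv/= num_real t0' t1'.
  have := cK x y (Itv.mk ti); rewrite !inE; exact.
apply/convex_setW => x y; rewrite !inE => Kx Ky k k0 k1.
by rewrite inE; apply: cK => //; rewrite k0 k1.
Qed.

End subspaces.

(** * Separation of a point from a convex set *)

Section convex_combinations.
Context (R : realType) (d : nat).
Implicit Types (u v x y : 'rV[R]_d) (K : set 'rV[R]_d) (V : 'M[R]_d).

Lemma convex_cone2 K (a b : R) x y : convex_set K -> 0 <= a -> 0 <= b -> K x -> K y ->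
  exists2 z, K z & a *: x + b *: y = (a + b) *: z.
Proof.
move=> /convex_setP cK; rewrite le_eqVlt => /predU1P[<-|a0].
  by move=> _ _ Ky; exists y => //; rewrite scale0r !add0r.
rewrite le_eqVlt => /predU1P[<-|b0] Kx Ky; first by exists x => //; rewrite scale0r !addr0.
have ab : 0 < a + b by exact: addr_gt0.
exists ((a / (a + b)) *: x + (1 - a / (a + b)) *: y).
  by apply: cK => //; rewrite divr_gt0//= ltr_pdivrMr// mul1r ltrDl.
by apply/rowP => i; rewrite !mxE; field; rewrite gt_eqF.
Qed.

Lemma convex_cone_sum K k (l : 'I_k -> R) (x : 'I_k -> 'rV[R]_d) :
    convex_set K -> K !=set0 -> (forall i, 0 <= l i) -> (forall i, K (x i)) ->
  exists2 z, K z & \sum_i l i *: x i = (\sum_i l i) *: z.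
Proof.
move=> cK K0 l0 Kx.
have [] : (exists2 z, K z & \sum_i l i *: x i = (\sum_i l i) *: z) /\ 0 <= \sum_i l i.
  elim/big_rec2: _ => [|i a y _ [[z Kz ->] a0]].
    by have [z Kz] := K0; split=> //; exists z => //; rewrite scale0r.
  split; last by rewrite addr_ge0.
  have [z' Kz' ->] := convex_cone2 cK (l0 i) a0 (Kx i) Kz.
  by exists z'.
by [].
Qed.

Lemma separation_finite K k (x : 'I_k.+1 -> 'rV[R]_d) :
    convex_set K -> ~ K 0 -> (forall i, K (x i)) ->
  exists2 u, K u & forall i, 0 <= dotv u (x i).
Proof.
move=> cK K0 Kx.
pose S := [set l : 'rV[R]_k.+1 | (forall i, 0 <= l ord0 i) /\ \sum_i l ord0 i = 1].
pose X := \matrix_i x i.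
have XE (l : 'rV[R]_k.+1) : l *m X = \sum_i l ord0 i *: x i.
  by rewrite mulmx_sum_row; apply: eq_bigr => i _; rewrite rowK.
have SK l : S l -> K (l *m X).
  move=> [l0 l1]; have [z Kz] := convex_cone_sum cK (ex_intro _ _ (Kx ord0)) l0 Kx.
  by rewrite l1 scale1r XE => ->.
pose e : 'rV[R]_k.+1 := const_mx 1.
have sumE (l : 'rV[R]_k.+1) : \sum_i l ord0 i = dotv e l.
  by apply: eq_bigr => i _; rewrite mxE mul1r.
have cS : compact S.
  apply: bounded_closed_compact.
    exists 1; split; first exact: num_real.
    move=> M M1 l [l0 l1]; rewrite /Num.norm/= mx_normrE.
    apply/bigmax_leP; split => [|[i j] _ /=]; first by rewrite (le_trans _ (ltW M1)).
    rewrite (ord1 i) ger0_norm// (le_trans _ (ltW M1))// -l1 (bigD1 j)//= lerDl.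
    by rewrite sumr_ge0.
  rewrite (_ : S = (\bigcap_(i in [set: 'I_k.+1]) [set l | 0 <= dotv (delta_mx ord0 i) l])
     `&` [set l | dotv e l = 1]).
    apply: closedI.
      apply: closed_bigI => i _.
      apply: (@preimage_closed _ _ (dotv (delta_mx ord0 i)) [set x | 0 <= x]).
        by move=> ? _; exact: dotv_continuous.
      exact: closed_ge.
    apply: (@preimage_closed _ _ (dotv e) [set x | x = 1]); last exact: closed_eq.
    by move=> ? _; exact: dotv_continuous.
  apply/seteqP; split => l /=; rewrite /S/= sumE => -[h1 h2]; split=> //.
    by move=> i _; rewrite /= dotv_delta.
  by move=> i; rewrite -dotv_delta; exact: h1.
have S0 : S !=set0.
  exists (delta_mx ord0 ord0); split=> [i|]; first by rewrite mxE ler0n.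
  rewrite (bigD1 ord0)//= mxE !eqxx big1 ?addr0// => i i0.
  by rewrite mxE (negbTE i0) andbF.
have cf : {within S, continuous (fun l : 'rV[R]_k.+1 => dotv (l *m X) (l *m X))}.
  apply: continuous_subspaceT.
  apply: (@continuous_big R 'I_d +%R 0 xpredT _ _ (index_enum _)
    (fun i (l : 'rV[R]_k.+1) => (l *m X) ord0 i * (l *m X) ord0 i)) => [|i _].
    by move=> z; apply: cvgD; [exact: cvg_fst|exact: cvg_snd].
  have ci : continuous (fun l : 'rV[R]_k.+1 => (l *m X) ord0 i).
    rewrite (_ : (fun _ => _) = dotv ((col i X)^T)); first exact: dotv_continuous.
    by apply/funext => l; rewrite mxE; apply: eq_bigr => j _; rewrite !mxE mulrC.
  by move=> l; exact: (cvgM (ci l) (ci l)).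
have [l lS lmin] := EVT_min_rV S0 cS cf.
rewrite inE in lS; pose u := l *m X.
have uK : K u by exact: SK.
exists u => // i; rewrite leNgt; apply/negP => ui.
have ux : dotv u (x i - u) < 0.
  by rewrite dotvDr dotvNr subr_lt0 (lt_le_trans ui)// dotv_ge0.
have key (t : R) : 0 <= t <= 1 ->
    0 <= t * (2 * dotv u (x i - u) + t * dotv (x i - u) (x i - u)).
  move=> /andP[t0 t1].
  have S' : S ((1 - t) *: l + t *: delta_mx ord0 i).
    have [l0 l1] := lS; split=> [j|].
      by rewrite !mxE addr_ge0// mulr_ge0// ?subr_ge0.
    have -> : \sum_i0 ((1 - t) *: l + t *: delta_mx ord0 i) ord0 i0 =
        (1 - t) * \sum_i0 l ord0 i0 + t.
      rewrite !sumE dotvDr !dotvZr; congr (_ + _).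
      rewrite -sumE (bigD1 i)//= mxE !eqxx big1 ?addr0 ?mulr1// => j ji.
      by rewrite mxE (negbTE ji) andbF.
    by rewrite l1 mulr1 subrK.
  have := lmin _ (mem_set S').
  rewrite mulmxDl -!scalemxAl -rowE rowK -/u.
  rewrite (_ : _ *: u + _ = u + t *: (x i - u)); last by apply/rowP => j; rewrite !mxE; ring.
  move: (x i - u) => w; rewrite dotvDl !dotvDr !dotvZl !dotvZr (dotvC w u).
  by rewrite -subr_ge0; congr (_ <= _); ring.
set a := dotv u (x i - u) in ux key; set b := dotv (x i - u) (x i - u) in key.
have b0 : 0 <= b by exact: dotv_ge0.
have s0 : 0 < b - a by lra.
have := key (- a / (b - a)); rewrite divr_ge0 ?(ltW s0) ?oppr_ge0 ?(ltW ux)//=.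
rewrite ler_pdivrMr// mul1r lerDr b0 => /(_ isT); apply/negP; rewrite -ltNge.
rewrite pmulr_rlt0; last by rewrite divr_gt0// oppr_gt0.
rewrite -(pmulr_rlt0 _ s0) (_ : (b - a) * _ = a * (b - 2 * a)); last by field; rewrite gt_eqF.
by rewrite nmulr_rlt0//; lra.
Qed.

Lemma separation K V : (forall x, K x -> (x <= V)%MS) -> convex_set K -> ~ K 0 ->
    V != 0 ->
  exists u, [/\ (u <= V)%MS, u != 0 & forall x, K x -> 0 <= dotv u x].
Proof.
move=> KV cK K0 V0.
have [KE|/set0P[x0 Kx0]] := eqVneq K set0.
  have [i Vi] : exists i, row i V != 0.
    apply: contrapT => /forallNP h; move/eqP: V0; apply; apply/row_matrixP => i.
    by rewrite row0; apply/eqP/negPn/negP; exact: h.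
  by exists (row i V); split=> //; [exact: row_sub|move=> x; rewrite KE].
pose S := [set u : 'rV[R]_d | (u <= V)%MS] `&` [set u | dotv u u = 1].
have cS : compact S.
  apply: bounded_closed_compact.
    exists 1; split; first exact: num_real.
    move=> M M1 u [_ /= u1]; rewrite /Num.norm/= mx_normrE.
    apply/bigmax_leP; split => [|[i j] _ /=]; first by rewrite (le_trans _ (ltW M1)).
    rewrite (le_trans _ (ltW M1))// (ord1 i).
    rewrite -(ler_pXn2r (n := 2))// ?nnegrE// expr1n real_normK ?num_real// -u1.
    rewrite /dotv (bigD1 j)//= -expr2 lerDl.
    by rewrite sumr_ge0// => m _; rewrite -expr2 sqr_ge0.
  apply: closedI; first exact: closed_rowspace.
  apply: (@preimage_closed _ _ (fun u => dotv u u) [set x | x = 1]); last exact: closed_eq.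
  move=> u _.
  apply: (@continuous_big R 'I_d +%R 0 xpredT _ _ (index_enum _)
    (fun i (l : 'rV[R]_d) => l ord0 i * l ord0 i)) => [|i _].
    by move=> z; apply: cvgD; [exact: cvg_fst|exact: cvg_snd].
  by move=> l; apply: (cvgM (@coord_continuous _ _ _ _ _ l) (@coord_continuous _ _ _ _ _ l)).
move: cS; rewrite compact_In0 => cS.
have [||u uP] := cS _ K (fun x => S `&` [set u | 0 <= dotv u x]).
- exists (fun x => [set u | 0 <= dotv u x]) => // x Kx.
  rewrite (_ : [set u | _] = dotv x @^-1` [set y | 0 <= y]); last first.
    by apply/funext => u /=; rewrite dotvC.
  by apply: preimage_closed; [move=> ? _; exact: dotv_continuous|exact: closed_ge].
- move=> D' D'K.
  pose s := x0 :: finmap.enum_fset D'.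
  pose x (i : 'I_(size (finmap.enum_fset D')).+1) := nth 0 s i.
  have sK y : y \in s -> K y.
    rewrite inE => /predU1P[->//|yD]; rewrite -inE; exact: D'K.
  have xK i : K (x i) by apply: sK; exact: mem_nth.
  have [u uK uP] := separation_finite cK K0 xK.
  have u0 : 0 < dotv u u.
    rewrite lt_neqAle dotv_ge0 andbT eq_sym; apply/eqP => /dotv_eq0 u0.
    by apply: K0; rewrite -u0.
  exists ((Num.sqrt (dotv u u))^-1 *: u) => y /= yD.
  have ys : y \in s by rewrite inE yD orbT.
  split; first split => /=.
  + by rewrite scalemx_sub//; exact: KV.
  + by rewrite dotvZl dotvZr mulrA -expr2 exprVn sqr_sqrtr ?ltW// mulVf// gt_eqF.
  + rewrite dotvZl mulr_ge0// ?invr_ge0 ?sqrtr_ge0//.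
    have iy : (index y s < (size (finmap.enum_fset D')).+1)%N by rewrite index_mem.
    by have := uP (Ordinal iy); rewrite /x/= -[nth _ _ _]/(nth 0 s (index y s)) nth_index.
have [[uV u1] _] := uP _ Kx0.
exists u; split=> //.
  by apply: contra_eq_neq u1 => ->; rewrite dotv0 eq_sym oner_neq0.
by move=> x Kx; have [_] := uP _ Kx.
Qed.

(* A lexicographic order for which K is positive, encoded as a sequence: after a
   functional l that is nonnegative on K, recurse on the hyperplane l = 0 to get
   v, and let l dominate: u s = v s + s (1 + |v s|) l. The trichotomy for all
   points of V reflects the totality of the lexicographic order. *)
Lemma separation_divergent K V :
    (forall x, K x -> (x <= V)%MS) -> convex_set K -> ~ K 0 ->
  exists u : nat -> 'rV[R]_d,
    (forall x, (x <= V)%MS -> [\/ x = 0, dotv (u s) x @[s --> \oo] --> +oo |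
       dotv (u s) x @[s --> \oo] --> -oo]) /\
    (forall x, K x -> dotv (u s) x @[s --> \oo] --> +oo).
Proof.
have [n] := ubnP (\rank V); elim: n V K => // n IH V K rV KV cK K0.
have [V0|V0] := eqVneq V 0.
  exists (fun=> 0); split=> [x|x /[dup] Kx /KV]; rewrite V0 submx0 => /eqP x0.
    by constructor 1.
  by exfalso; apply: K0; rewrite -x0.
have [l [lV l0 lK]] := separation KV cK K0 V0.
pose V' := (V :&: kermx l^T)%MS.
have V'P x : (x <= V')%MS = (x <= V)%MS && (dotv l x == 0).
  rewrite sub_capmx; congr (_ && _); apply/sub_kermxP/eqP => [x0|].
    by rewrite dotvC dotvE x0 mxE.
  by rewrite dotvC dotvE => x0; apply/rowP => i; rewrite (ord1 i) x0 mxE.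
have [||||v [vV vK]] := IH V' (K `&` [set x | dotv l x = 0]).
- rewrite -ltnS (leq_trans _ rV)// ltnS.
  have : (V' < V)%MS.
    rewrite /ltmx capmxSl/=; apply/negP => VV'.
    have : (l <= V')%MS by exact: submx_trans VV'.
    by rewrite V'P lV => /eqP /dotv_eq0 /eqP; apply/negP.
  by move=> /rank_ltmx.
- by move=> x [Kx /= lx]; rewrite V'P KV//= lx.
- apply/convex_setP => t x y [Kx/= lx] [Ky/= ly] t01; split.
    by move/convex_setP : cK; apply.
  by rewrite /= dotvDr !dotvZr lx ly !mulr0 addr0.
- by case.
pose N x := \sum_i `|x ord0 i| : R.
have N0 x : 0 <= N x by rewrite sumr_ge0.
pose u s := v s + (s%:R * (1 + N (v s))) *: l.
have uE s x : dotv (u s) x = dotv (v s) x + s%:R * (1 + N (v s)) * dotv l x.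
  by rewrite dotvDl dotvZl.
have upos x : 0 < dotv l x -> dotv (u s) x @[s --> \oo] --> +oo.
  move=> lx; apply/cvgryPge => A.
  near=> s.
  have vx : - (N (v s) * N x) <= dotv (v s) x.
    by have := normr_dotv_le (v s) x; rewrite ler_norml => /andP[].
  have h1 : N x <= s%:R * dotv l x.
    rewrite -ler_pdivrMr//; near: s; exact: nbhs_infty_ger.
  have h2 : A <= s%:R * dotv l x.
    rewrite -ler_pdivrMr//; near: s; exact: nbhs_infty_ger.
  rewrite uE; apply: (le_trans h2).
  have : 0 <= N (v s) * (s%:R * dotv l x - N x) by rewrite mulr_ge0// subr_ge0.
  rewrite mulrBr => h3.
  have -> : s%:R * (1 + N (v s)) * dotv l x = s%:R * dotv l x + N (v s) * (s%:R * dotv l x) by ring.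
  lra.
have uneg x : dotv l x < 0 -> dotv (u s) x @[s --> \oo] --> -oo.
  move=> lx; apply/cvgNry.
  rewrite (_ : - _ = fun s => dotv (u s) (- x)); last first.
    by apply/funext => s; rewrite dotvNr.
  by apply: upos; rewrite dotvNr oppr_gt0.
have u0 x : dotv l x = 0 -> (fun s => dotv (u s) x) = (fun s => dotv (v s) x).
  by move=> lx; apply/funext => s; rewrite uE lx mulr0 addr0.
exists u; split=> [x xV|x Kx].
  have [lx|lx|lx] := ltgtP (dotv l x) 0.
  - by constructor 3; exact: uneg.
  - by constructor 2; exact: upos.
  - by rewrite u0//; apply: vV; rewrite V'P xV lx eqxx.
have := lK _ Kx; rewrite le_eqVlt => /predU1P[lx|]; last exact: upos.
by rewrite u0//; exact: vK.
Unshelve. all: by end_near. Qed.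

End convex_combinations.
(** * Convex sets of positive measure meet the convex core *)

Section borel_sets.
Context (R : realType) (d : nat).
Implicit Types (u v x y : 'rV[R]_d) (K : set 'rV[R]_d) (V : 'M[R]_d).

Lemma open_measurable_mx (A : set 'rV[R]_d) : open A -> measurable A.
Proof. by move=> oA; apply: sub_sigma_algebra. Qed.

Lemma closed_measurable_mx (A : set 'rV[R]_d) : closed A -> measurable A.
Proof.
move=> cA; rewrite -[A]setCK; apply: measurableC; apply: open_measurable_mx.
exact: closed_openC.
Qed.

Lemma affine_measurable (A : set 'rV[R]_d) : affine_set A -> measurable A.
Proof. by move=> /closed_affine; exact: closed_measurable_mx. Qed.

Lemma dotv_measurable u : measurable_fun setT (dotv u).
Proof.
apply: (measurability _ (RGenOpens.measurableE R)) => _ [_ [a [b ->] <-]].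
rewrite setTI; apply: open_measurable_mx.
by apply: open_comp; [move=> ? _; exact: dotv_continuous|exact: interval_open].
Qed.

(* Stated for any ideal of null sets, to cover both probability measures and
   restrictions of mu. *)
Lemma affine_support (null : set 'rV[R]_d -> Prop) :
    (forall A B, A `<=` B -> null B -> null A) ->
    (forall A B, null A -> null B -> null (A `|` B)) ->
    null set0 -> ~ null setT ->
  exists x V, null (~` flat x V) /\
    forall B, affine_set B -> null (~` B) -> flat x V `<=` B.
Proof.
move=> nullS nullU null0 nullT.
pose T n := `[< exists x (V : 'M[R]_d), \rank V = n /\ null (~` flat x V) >].
have exT : exists n, T n.
  exists (\rank (1%:M : 'M[R]_d)); apply/asboolP; exists 0, 1%:M; split=> //.
  by apply: nullS null0 => y; apply; rewrite /flat/= submx1.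
case: (ex_minnP exT) => n /asboolP[x [V [rV Vx]]] minn; exists x, V; split=> // B affB Bx.
have nullI : null (~` (flat x V `&` B)) by rewrite setCI; exact: nullU.
have [E|/set0P[y [xy By]]] := eqVneq (flat x V `&` B) set0.
  by exfalso; apply: nullT; rewrite -setC0 -E.
have aff := affine_setI (@affine_flat _ _ x V) affB.
have [W FW] := affine_setP aff (conj xy By).
have WV : (W <= V)%MS.
  apply/rV_subP => w wW; have : (flat x V `&` B) (y + w).
    by rewrite FW flat_addr.
  by move=> [xyw _]; rewrite -[w](addKr y) addrC; exact: flat_sub xyw xy.
have : (\rank V <= \rank W)%N by rewrite rV; apply: minn; apply/asboolP; exists y, W; rewrite -FW.
move=> rVW z xz.
have VW : (V <= W)%MS.
  by have := mxrank_leqif_sup WV; case=> _ <-; rewrite eqn_leq rVW mxrankS.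
have : (flat x V `&` B) z.
  by rewrite FW /flat/= (submx_trans _ VW)//; exact: flat_sub xz xy.
by case.
Qed.

End borel_sets.

Section mean.
Context (R : realType) (d : nat) (mu : {finite_measure set 'rV[R]_d -> \bar R}).
Implicit Types (u v x y : 'rV[R]_d) (D K : set 'rV[R]_d) (V : 'M[R]_d).

Definition coord_bounded D := exists M : R, forall x, D x -> forall i, `|x ord0 i| <= M.

Lemma dotv_integrable D u : measurable D -> coord_bounded D ->
  mu.-integrable D (EFin \o dotv u).
Proof.
move=> mD [M DM]; apply: measurable_bounded_integrable => //.
- by rewrite ltey_eq fin_num_measure.
- by apply: measurable_funTS; exact: dotv_measurable.
- exists ((\sum_i `|u ord0 i|) * (\sum_(i < d) M)); split; first exact: num_real.
  move=> M' /ltW MM' x Dx; apply: le_trans MM'.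
  rewrite (le_trans (normr_dotv_le _ _))// ler_wpM2l ?sumr_ge0//.
  by apply: ler_sum => i _; exact: DM.
Qed.

Lemma exists_mean D : measurable D -> coord_bounded D -> mu D <> 0%E ->
  exists m, forall u, (\int[mu]_(x in D) (dotv u (x - m))%:E = 0)%E.
Proof.
move=> mD bD muD0.
pose c := fine (mu D).
have muD : mu D = c%:E by rewrite fineK// fin_num_measure.
have c0 : c != 0 by apply/eqP => c0; apply: muD0; rewrite muD c0.
pose e i : 'rV[R]_d := delta_mx ord0 i.
pose I u := (\int[mu]_(x in D) (dotv u x)%:E)%E.
have Ifin u : I u \is a fin_num by apply: integrable_fin_num => //; exact: dotv_integrable.
exists (\row_i (fine (I (e i)) / c)) => u.
set m := \row_i _.
under eq_integral do rewrite dotvDr dotvNr EFinB.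
rewrite integralB//; [|exact: dotv_integrable|exact: finite_measure_integrable_cst].
have -> : (\int[mu]_(x in D) (cst (dotv u m)%:E x) = (dotv u m * c)%:E)%E.
  by rewrite integral_cst// EFinM -muD.
have -> : (\int[mu]_(x in D) (dotv u x)%:E = (\sum_i u ord0 i * fine (I (e i)))%:E)%E.
  under eq_integral do rewrite /dotv -sumEFin.
  rewrite integral_sum//; last first.
    move=> i; under eq_fun => x do rewrite -(dotv_delta i x) EFinM.
    by apply: integrableZl => //; exact: dotv_integrable.
  rewrite -sumEFin; apply: eq_bigr => i _.
  rewrite EFinM fineK//.
  under eq_integral => x _ do rewrite -(dotv_delta i x) EFinM.
  by rewrite integralZl//; exact: dotv_integrable.
rewrite -EFinB; congr EFin; rewrite /dotv mulr_suml -sumrB big1// => i _.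
by rewrite mxE -mulrA divfK// subrr.
Qed.

Lemma mean_ge0_negligible D u m : measurable D -> coord_bounded D ->
    (\int[mu]_(x in D) (dotv u (x - m))%:E = 0)%E ->
    mu.-negligible (D `&` [set x | dotv u (x - m) < 0]) ->
  mu.-negligible (D `&` [set x | dotv u (x - m) <> 0]).
Proof.
move=> mD bD I0 neg.
pose h x := dotv u (x - m).
have mg : measurable_fun D (EFin \o h).
  apply/measurable_EFinP; rewrite /h; under eq_fun do rewrite dotvDr dotvNr.
  apply: measurable_funB => //; first by apply: measurable_funTS; exact: dotv_measurable.
have hg : ae_eq mu D (fun x => `|(EFin \o h) x|)%E (EFin \o h).
  apply: negligibleS neg => x /= /not_implyP[Dx gx]; split=> //=.
  rewrite ltNge; apply/negP => g0; apply: gx.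
  by rewrite ger0_norm.
have /ae_eq_integral_abs : (\int[mu]_(x in D) `|(EFin \o h) x| = 0)%E.
  by rewrite (@ae_eq_integral _ _ _ mu D (EFin \o h))//; exact: measurableT_comp.
move=> /(_ mD mg); apply: negligibleS => x [Dx gx] /= /(_ Dx) [].
exact: gx.
Qed.

(* If the mean m were not in K, a functional separating m from K would be
   constant a.e. on D, contradicting the minimality of the affine support. *)
Lemma convex_mean D : measurable D -> coord_bounded D -> mu D <> 0%E ->
  exists m, forall K, convex_set K -> mu.-negligible (D `\` K) -> K m.
Proof.
move=> mD bD muD0; have [m mean] := exists_mean mD bD muD0.
have mean0 u : mu.-negligible (D `&` [set x | dotv u (x - m) < 0]) ->
    mu.-negligible (D `&` [set x | dotv u (x - m) <> 0]).
  exact: mean_ge0_negligible (mean u).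
exists m => K cK DK.
have [||||x0 [V [AD Amin]]] := @affine_support R d (fun B => mu.-negligible (D `&` B)).
- by move=> A B AB; apply: negligibleS; exact: setIS.
- by move=> A B nA nB; rewrite setIUr; exact: negligibleU.
- by rewrite setI0; exact: negligible_set0.
- by rewrite setIT => /(negligibleP _ mD).
set A := flat x0 V in AD Amin.
have affH u y : affine_set [set x | dotv u (x - y) = 0].
  move=> t x z /= ex ez.
  rewrite (_ : _ - y = t *: (x - y) + (1 - t) *: (z - y)); last by apply/rowP => i; rewrite !mxE; ring.
  by rewrite dotvDr !dotvZr ex ez !mulr0 addr0.
have Am : A m.
  have [p [pV pE]] := orthogonal_projection V.
  pose w := m - x0; pose u := w - w *m p.
  have uV v : (v <= V)%MS -> dotv u v = 0 by move=> vV; rewrite dotvDl dotvNl pE// subrr.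
  suff u0 : dotv u w = 0.
    have : dotv u u = 0 by rewrite {2}/u dotvDr dotvNr u0 uV// subrr.
    by move=> /dotv_eq0/eqP; rewrite subr_eq0 => /eqP e; rewrite /A /flat/= -/w e.
  have AE x : A x -> dotv u (x - m) = - dotv u w.
    move=> Ax; rewrite (_ : x - m = (x - x0) - w); last by apply/rowP => i; rewrite !mxE; ring.
    by rewrite dotvDr dotvNr uV// add0r.
  apply: contrapT => u0.
  have : forall s : R, mu.-negligible (D `&` [set x | dotv (s *: u) (x - m) < 0]) -> s = 0.
    move=> s /mean0 ns; apply: contrapT => s0; apply: muD0; apply/(negligibleP _ mD).
    apply: negligibleS (negligibleU ns AD) => x Dx.
    have [Ax|] := pselect (A x); last by right.
    left; split=> //=; rewrite dotvZl AE//; apply/eqP; rewrite mulf_neq0 ?oppr_eq0//; exact/eqP.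
  move=> /(_ (- dotv u w)) /=.
  have h : mu.-negligible (D `&` [set x | dotv ((- dotv u w) *: u) (x - m) < 0]).
    apply: negligibleS AD => x [Dx /= lt0]; split=> // Ax.
    by move: lt0; rewrite dotvZl AE// -expr2 ltNge sqr_ge0.
  by move=> /(_ h) /eqP; rewrite oppr_eq0 => /eqP.
apply: contrapT => Km.
have AK : mu.-negligible (D `&` ~` (A `&` K)).
  by rewrite setCI setIUr; apply: negligibleU => //; rewrite -setDE.
have [V0|V0] := eqVneq V 0.
  apply: muD0; apply/(negligibleP _ mD); apply: negligibleS AK => x Dx; split=> // -[Ax Kx].
  apply: Km; suff -> : m = x by [].
  move: Ax Am; rewrite /A /flat/= V0 !submx0 => /eqP e /eqP e'.
  by apply/eqP; rewrite -subr_eq0 -[m](subrK x0) e' add0r -opprB e oppr0.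
have := @separation R d [set x - m | x in A `&` K] V.
case=> //.
- move=> _ [x [Ax _] <-].
  exact: flat_sub Ax Am.
- apply/convex_setP => t _ _ [x [Ax Kx] <-] [y [Ay Ky] <-] t01.
  exists (t *: x + (1 - t) *: y); last by apply/rowP => i; rewrite !mxE; ring.
  by split; [exact: affine_flat|move/convex_setP : cK; apply].
- by move=> [x [Ax Kx] /eqP]; rewrite subr_eq0 => /eqP e; apply: Km; rewrite -e.
move=> u [uV u0 uK].
have : mu.-negligible (D `&` [set x | dotv u (x - m) < 0]).
  apply: negligibleS AK => x [Dx /= ux]; split=> // -[Ax Kx].
  by move: ux; rewrite ltNge uK//; exists x.
move=> /mean0 nu0.
have : (m + u) \in A by rewrite inE /A /flat/= addrAC addmx_sub.
rewrite inE => /(Amin _ (affH u m) nu0) /=.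
by rewrite addrAC subrr add0r => /dotv_eq0/eqP; apply/negP.
Qed.

Lemma convex_core_meets K : convex_set K -> measurable K -> mu K <> 0%E ->
  convex_core mu `&` K !=set0.
Proof.
move=> cK mK muK.
pose D n := K `&` \bigcap_(i in [set: 'I_d]) [set x | `|dotv (delta_mx ord0 i) x| <= n%:R].
have mD n : measurable (D n).
  apply: measurableI => //; apply: fin_bigcap_measurable; first exact: finite_finset.
  move=> i _; rewrite (_ : [set x | _] = setT `&` dotv (delta_mx ord0 i) @^-1` `[- n%:R, n%:R]).
    by apply: dotv_measurable => //; exact: measurable_itv.
  by rewrite setTI; apply/seteqP; split=> x /=; rewrite in_itv/= ler_norml.
have [n Dn] : exists n, mu (D n) <> 0%E.
  apply: contrapT => /forallNP h; apply: muK; apply/(negligibleP _ mK).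
  have : mu.-negligible (\bigcup_n D n).
    by apply: negligible_bigcup => n; apply/(negligibleP _ (mD n)); have /contrapT := h n.
  apply: negligibleS => x Kx.
  exists (Num.bound (\sum_i `|x ord0 i|)) => //; split=> // i _ /=.
  rewrite dotv_delta (le_trans _ (ltW (archi_boundP _)))// ?sumr_ge0//.
  by rewrite (bigD1 i)//= lerDl sumr_ge0.
have [m mP] : exists m, forall K, convex_set K -> mu.-negligible (D n `\` K) -> K m.
  apply: convex_mean => //; exists n%:R => x [_ Dx] i; rewrite -dotv_delta; exact: Dx.
exists m; split.
  move=> C [mC cC CT]; apply: mP => //.
  have : mu (~` C) = 0%E.
    have h : mu (setT `\` C) = (mu setT - mu (setT `&` C))%E.
      by apply: measureD => //; rewrite ltey_eq fin_num_measure.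
    by rewrite -setTD h setTI CT subee// fin_num_measure.
  move=> /(negligibleP _ (measurableC mC)); apply: negligibleS => x [_]; exact.
apply: mP => //; rewrite (_ : _ `\` _ = set0); first exact: negligible_set0.
by apply/seteqP; split => x // [[]].
Qed.

End mean.
(** * Faces of the convex core *)

Section divergence.
Context (R : realType).
Implicit Types (f g : nat -> R) (t M : R).

Lemma cvgNy_convex f g t M : 0 < t < 1 -> f s @[s --> \oo] --> -oo ->
  (\forall s \near \oo, g s <= M) -> t * f s + (1 - t) * g s @[s --> \oo] --> -oo.
Proof.
move=> /andP[t0 t1] /cvgrNyPle fNy gM; apply/cvgrNyPle => A.
have h := fNy ((A - (1 - t) * M) / t).
near=> s.
have fs : f s <= (A - (1 - t) * M) / t by near: s; exact: h.
have gs : g s <= M by near: s; exact: gM.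
have : t * f s <= A - (1 - t) * M by rewrite mulrC -ler_pdivlMr.
have : (1 - t) * g s <= (1 - t) * M by rewrite ler_wpM2l// subr_ge0 ltW.
lra.
Unshelve. all: by end_near. Qed.

Lemma cvgNy_bounded f : f s @[s --> \oo] --> -oo -> \forall s \near \oo, f s <= 0.
Proof. by move=> /cvgrNyPle; exact. Qed.

Lemma cvg_bounded_above f (l : R) : f s @[s --> \oo] --> l -> \forall s \near \oo, f s <= l + 1.
Proof.
move=> /cvgrPdist_lt/(_ 1 ltr01); apply: filterS => s.
by rewrite ltr_norml; lra.
Qed.

Lemma measurable_cvgNy d (T : measurableType d) (f : nat -> T -> R) :
  (forall n, measurable_fun setT (f n)) -> measurable [set x | f n x @[n --> \oo] --> -oo].
Proof.
move=> mf.
rewrite (_ : [set x | _] = \bigcap_m \bigcup_n \bigcap_(k in [set k | (n <= k)%N])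
    [set x | f k x <= - m%:R]); last first.
  apply/seteqP; split=> x /=.
    move=> /cvgrNyPle h m _; have [n _ hn] := h (- m%:R).
    by exists n => // k /= nk; exact: hn.
  move=> h; apply/cvgrNyPle => A.
  have [n _ hn] := h (Num.bound `|A|) I.
  exists n => // k /= nk; rewrite (le_trans (hn _ nk))// lerNl.
  by rewrite (le_trans (ler_norm _))// normrN ltW// archi_boundP.
apply: bigcapT_measurable => m; apply: bigcupT_measurable => n.
apply: bigcap_measurable; first by exists n => /=.
move=> k _; rewrite -[X in measurable X]setTI.
rewrite (_ : [set x | _] = f k @^-1` `]-oo, - m%:R]); first exact: mf.
by apply/seteqP; split => x /=; rewrite in_itv.
Qed.

End divergence.

Section faces.
Context (R : realType) (d : nat).
Implicit Types (u v x y : 'rV[R]_d) (C F : set 'rV[R]_d) (V : 'M[R]_d).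

(* The affine combinations of points of F reduce to two points: the positive and
   the negative part each collapse to a multiple of a single point of F. *)
Lemma affine_hull_convex F x : convex_set F -> affine_hull F x ->
  exists b p q, [/\ 0 <= b, F p, F q & x = (1 + b) *: p - b *: q].
Proof.
move=> cF.
pose S (c : R) y := exists a b p q,
  [/\ 0 <= a, 0 <= b, F p /\ F q & a - b = c /\ y = a *: p - b *: q].
have SZ t c y : S c y -> S (t * c) (t *: y).
  move=> [a [b [p [q [a0 b0 [Fp Fq] [<- ->]]]]]].
  have [t0|t0] := leP 0 t.
    exists (t * a), (t * b), p, q; split; rewrite ?mulr_ge0//; split=> //; first by ring.
    by rewrite scalerBr !scalerA.
  exists (- t * b), (- t * a), q, p; split; rewrite ?mulr_ge0// ?oppr_ge0 ?ltW//.
  by split=> //; [ring|apply/rowP => i; rewrite !mxE; ring].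
have SD c c' y y' : S c y -> S c' y' -> S (c + c') (y + y').
  move=> [a [b [p [q [a0 b0 [Fp Fq] [<- ->]]]]]].
  move=> [a' [b' [p' [q' [a0' b0' [Fp' Fq'] [<- ->]]]]]].
  have [z Fz zE] := convex_cone2 cF a0 a0' Fp Fp'.
  have [w Fw wE] := convex_cone2 cF b0 b0' Fq Fq'.
  exists (a + a'), (b + b'), z, w; split; rewrite ?addr_ge0//; split; first by ring.
  by rewrite -zE -wE opprD addrACA.
have affS : affine_set (S 1).
  move=> t y z Sy Sz; have := SD _ _ _ _ (SZ t _ _ Sy) (SZ (1 - t) _ _ Sz).
  by rewrite !mulr1 addrC subrK.
have FS : F `<=` S 1.
  move=> y Fy; exists 1, 0, y, y; split => //.
  by split; [exact: subr0|rewrite scale0r subr0 scale1r].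
move=> /(affine_hull_sub affS FS) [a [b [p [q [a0 b0 [Fp Fq] [ab ->]]]]]].
by exists b, p, q; split=> //; rewrite -ab subrK.
Qed.

Lemma face_affine_hull C F : is_face C F -> C `&` affine_hull F = F.
Proof.
move=> [F0 cF FC face]; apply/seteqP; split=> x; last first.
  by move=> Fx; split; [exact: FC|exact: sub_affine_hull].
move=> [Cx /(affine_hull_convex cF)[b [p [q [b0 Fp Fq xE]]]]].
move: b0; rewrite le_eqVlt => /predU1P[b0|b0].
  by rewrite xE -b0 addr0 scale0r subr0 scale1r.
have b1 : 0 < 1 + b by rewrite addr_gt0.
have pE : p = (1 + b)^-1 *: x + (1 - (1 + b)^-1) *: q.
  by rewrite xE; apply/rowP => i; rewrite !mxE; field; rewrite gt_eqF.
have [] := face (1 + b)^-1 x q Cx (FC _ Fq); rewrite -?pE//.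
by rewrite invr_gt0 b1/= invf_lt1// ltrDl.
Qed.

Lemma closure_sub_affine_hull F : closure F `<=` affine_hull F.
Proof.
rewrite closureE; apply: smallest_sub; last exact: sub_affine_hull.
by apply: closed_affine; exact: affine_affine_hull.
Qed.

End faces.

Section convex_core_faces.
Context (R : realType) (d : nat) (mu : {finite_measure set 'rV[R]_d -> \bar R}).
Implicit Types (u v x y : 'rV[R]_d) (A F : set 'rV[R]_d) (V : 'M[R]_d).

Lemma convex_convex_core : convex_set (convex_core mu).
Proof.
apply/convex_setP => t x y Cx Cy t01 K KP.
have [_ /convex_setP cK _] := KP; apply: cK => //; [exact: Cx|exact: Cy].
Qed.

(* A grid cell that misses F meets A in a convex set disjoint from the convex
   core, hence in a null set; countably many such cells cover A \ cl F. *)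
Lemma convex_core_closure A : convex_set A -> measurable A ->
  mu.-negligible (A `\` closure (convex_core mu `&` A)).
Proof.
move=> cA mA; set F := _ `&` A.
pose cell (nk : nat * 'rV[int]_d) := [set x : 'rV[R]_d | forall i,
  ((nk.2 ord0 i)%:~R <= nk.1.+1%:R * x ord0 i < (nk.2 ord0 i)%:~R + 1)%R].
have mcell nk : measurable (cell nk).
  rewrite (_ : cell nk = \bigcap_(i in [set: 'I_d]) (setT `&` dotv (nk.1.+1%:R *: delta_mx ord0 i) @^-1`
      `[(nk.2 ord0 i)%:~R, (nk.2 ord0 i)%:~R + 1[)).
    apply: fin_bigcap_measurable; first exact: finite_finset.
    by move=> i _; apply: dotv_measurable => //; exact: measurable_itv.
  apply/seteqP; split=> x /= h i; first by split=> //=; rewrite in_itv/= dotvZl dotv_delta.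
  by have [//|_] := h i; rewrite /= in_itv/= dotvZl dotv_delta.
have ccell nk : convex_set (cell nk).
  apply/convex_setP => t x y cx cy /andP[t0 t1] i; rewrite !mxE.
  have /andP[x1 x2] := cx i; have /andP[y1 y2] := cy i.
  set a := _%:~R in x1 x2 y1 y2 *; set n := _%:R in x1 x2 y1 y2 *.
  have -> : n * (t * x ord0 i + (1 - t) * y ord0 i) = t * (n * x ord0 i) + (1 - t) * (n * y ord0 i) by ring.
  have t1' : 0 < 1 - t by rewrite subr_gt0.
  have := ler_wpM2l (ltW t0) x1; have := ler_wpM2l (ltW t1') y1.
  have : t * (n * x ord0 i) < t * (a + 1) by rewrite ltr_pM2l.
  have : (1 - t) * (n * y ord0 i) < (1 - t) * (a + 1) by rewrite ltr_pM2l.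
  move=> h1 h2 h3 h4; apply/andP; split; lra.
pose N (j : nat) := if unpickle j is Some nk then
  [set x | [/\ A x, cell nk x & cell nk `&` F = set0]] else set0.
have : mu.-negligible (\bigcup_j N j).
  apply: negligible_bigcup => j; rewrite /N; case: unpickle => [nk|]; last exact: negligible_set0.
  have [E|E] := eqVneq (cell nk `&` F) set0; last first.
    rewrite (_ : [set x | _] = set0); first exact: negligible_set0.
    by apply/seteqP; split=> x // [_ _ /eqP]; rewrite (negbTE E).
  have mAc : measurable (A `&` cell nk) by exact: measurableI.
  apply: (@negligibleS _ _ _ _ (A `&` cell nk)); first by move=> x [].
  apply/negligibleP => //; apply: contrapT => ne0.
  have cAc : convex_set (A `&` cell nk).
    apply/convex_setP => t x y [Ax cx] [Ay cy] t01.
    by split; [move/convex_setP : cA; apply|move/convex_setP : (ccell nk); apply].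
  have [y [Cy [Ay cy]]] := convex_core_meets cAc mAc ne0.
  by have : (cell nk `&` F) y by []; rewrite E.
apply: negligibleS => x [Ax nclx].
have [e e0 eF] : exists2 e : R, 0 < e & forall y, (forall i, `|x ord0 i - y ord0 i| < e) -> ~ F y.
  apply: contrapT => h; apply: nclx => B /nbhs_ballP[e /= e0 eB].
  apply: contrapT => FB; apply: h; exists e => // y xy Fy; apply: FB; exists y; split => //.
  by apply: eB; split => // i j; rewrite (ord1 i); exact: xy.
pose n := Num.bound e^-1.
have ne : n.+1%:R^-1 < e.
  rewrite invf_plt ?posrE// (lt_trans (archi_boundP _)) ?invr_ge0 ?ltW//.
  by rewrite ltr_nat.
pose k : 'rV[int]_d := \row_i Num.floor (n.+1%:R * x ord0 i).
exists (pickle (n, k)) => //; rewrite /N pickleK; split=> //.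
  by move=> i /=; rewrite mxE -intrD1 Num.Theory.floor_itv.
apply/seteqP; split=> y // [cy]; apply: eF => i.
rewrite (le_lt_trans _ ne)// -(ler_pM2l (_ : 0 < n.+1%:R)) ?ltr0n// divff ?pnatr_eq0//.
rewrite -[X in X * _]ger0_norm// -normrM mulrBr.
have /andP[y1 y2] := cy i; move: y1 y2; rewrite /= mxE => y1 y2.
have := Num.Theory.floor_itv (n.+1%:R * x ord0 i); rewrite intrD1 => /andP[x1 x2].
by rewrite ler_norml; lra.
Qed.

Lemma face_closure F : is_face (convex_core mu) F ->
  mu.-negligible (affine_hull F `\` closure F).
Proof.
move=> faceF; rewrite -[in closure F](face_affine_hull faceF).
have affF := @affine_affine_hull _ _ F.
by apply: convex_core_closure; [exact: affine_convex|exact: affine_measurable].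
Qed.

Lemma face_divergent F x0 : is_face (convex_core mu) F -> F x0 ->
  exists u : nat -> 'rV[R]_d,
    (forall s v, lin F v -> dotv (u s) v = 0) /\
    mu.-negligible (~` (affine_hull F `|` [set x | dotv (u s) (x - x0) @[s --> \oo] --> +oo])).
Proof.
move=> faceF Fx0; have FE := face_affine_hull faceF; have [_ _ FC face] := faceF.
have [V AV] := affine_setP (@affine_affine_hull _ _ F) (sub_affine_hull Fx0).
have [p [pV pE]] := orthogonal_projection V.
have psym v w : dotv (v *m p) w = dotv v (w *m p).
  by rewrite dotvC -[RHS]pE// -(pE w)// dotvC.
pose K := [set (y - x0) *m (1%:M - p) | y in convex_core mu `\` F].
have [|||u [u3 uK]] := @separation_divergent R d K (1%:M - p).
- by move=> _ [y _ <-]; exact: submxMl.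
- apply/convex_setP => t _ _ [y [Cy Fy] <-] [z [Cz Fz] <-] t01.
  exists (t *: y + (1 - t) *: z).
    split; first by move/convex_setP : convex_convex_core; apply.
    by move=> /(face _ _ _ Cy Cz t01) [].
  rewrite !scalemxAl -mulmxDl; congr (_ *m _); apply/rowP => i; rewrite !mxE; ring.
- move=> [y [Cy Fy]]; rewrite mulmxBr mulmx1 => /eqP; rewrite subr_eq0 => /eqP e.
  by apply: Fy; rewrite -FE AV; split=> //; rewrite /flat/= e.
pose w s := u s *m (1%:M - p).
have wE s v : dotv (w s) v = dotv (u s) (v *m (1%:M - p)).
  by rewrite /w !mulmxBr !mulmx1 dotvDl dotvDr dotvNl dotvNr psym.
have wF s v : lin F v -> dotv (w s) v = 0.
  rewrite (lin_flat AV) /= => vV.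
  by rewrite /w mulmxBr mulmx1 dotvDl dotvNl pE// subrr.
exists w; split=> //.
(* A convex set that misses the core, by the trichotomy, hence a null set. *)
pose Neg := [set x | dotv (w s) (x - x0) @[s --> \oo] --> -oo].
have mNeg : measurable Neg.
  apply: measurable_cvgNy => n; under eq_fun do rewrite dotvDr dotvNr.
  by apply: measurable_funB => //; exact: dotv_measurable.
have cNeg : convex_set Neg.
  apply/convex_setP => t x y xN yN t01; rewrite /Neg/=.
  rewrite (_ : (fun s => _) = fun s => t * dotv (w s) (x - x0) + (1 - t) * dotv (w s) (y - x0)).
    exact: cvgNy_convex t01 xN (cvgNy_bounded yN).
  apply/funext => s; rewrite -!dotvZr -dotvDr; congr dotv.
  by apply/rowP => i; rewrite !mxE; ring.
have : mu.-negligible Neg.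
  apply/negligibleP => //; apply: contrapT => ne0.
  have [y [Cy /= yN]] := convex_core_meets cNeg mNeg ne0.
  have [Fy|Fy] := pselect (F y).
    have /cvgrNyPle/(_ (-1)) := yN => -[n _ /(_ n (leqnn _))] /=.
    rewrite wF ?lerN10// => [|]; last first.
      by rewrite (lin_flat AV)/=; move: (sub_affine_hull Fy); rewrite AV.
    by rewrite lerNr oppr0 ler10.
  have /cvgryPge/(_ 1)[n _ hn] : dotv (w s) (y - x0) @[s --> \oo] --> +oo.
    by under eq_fun do rewrite wE; apply: uK; exists y.
  have /cvgrNyPle/(_ 0)[m _ hm] := yN.
  have := le_trans (hn (maxn n m) (leq_maxl _ _)) (hm (maxn n m) (leq_maxr _ _)).
  by rewrite ler10.
apply: negligibleS => x /not_orP[xF /= nxy]; rewrite /Neg/=.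
have := u3 ((x - x0) *m (1%:M - p)) (submxMl _ _).
under eq_fun do rewrite -wE.
case=> // /eqP; rewrite mulmxBr mulmx1 subr_eq0 => /eqP e.
by exfalso; apply: xF; rewrite AV /flat/= e.
Qed.

End convex_core_faces.
(** * Densities and variation distance *)

Section convergence_in_measure.
Context d (T : measurableType d) (R : realType) (mu : {finite_measure set T -> \bar R}).
Implicit Types (f g : T -> R).
Local Open Scope ereal_scope.

Lemma borel_cantelli_half (F : nat -> set T) : (forall n, measurable (F n)) ->
  (forall n, mu (F n) <= (2 ^- n.+1)%:E) -> mu (lim_sup_set F) = 0.
Proof.
move=> mF muF; apply: lim_sup_set_cvg0 => //.
apply: (@le_lt_trans _ _ 1); last exact: ltry.
apply: lime_le; first exact: is_cvg_ereal_nneg_natsum_cond.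
apply: nearW => n; apply: (@le_trans _ _ (\sum_(0 <= i < n) (2 ^- i.+1)%:E)).
  by apply: lee_sum => i _; exact: muF.
rewrite sumEFin lee_fin.
suff -> : (\sum_(0 <= i < n) 2 ^- i.+1 = 1 - 2 ^- n :> R)%R.
  by rewrite gerBl invr_ge0 exprn_ge0.
elim: n => [|n IH]; first by rewrite big_geq// expr0 invr1 subrr.
rewrite big_nat_recr//= IH exprS invfM.
by set a := (2 ^+ n)^-1%R; lra.
Qed.

Lemma cvg_ae_measure (h : nat -> T -> R) f (e : R) : (0 < e)%R ->
  (forall n, measurable_fun setT (h n)) -> measurable_fun setT f ->
  mu.-negligible [set x | ~ (h n x @[n --> \oo] --> f x)] ->
  exists n, mu [set x | (e <= `|h n x - f x|)%R] < e%:E.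
Proof.
move=> e0 mh mf hf.
pose E n := [set x | (e <= `|h n x - f x|)%R].
have mE n : measurable (E n).
  rewrite (_ : E n = setT `&` (fun x => `|h n x - f x|)%R @^-1` `[e, +oo[); last first.
    by rewrite setTI; apply/seteqP; split=> x /=; rewrite in_itv/= andbT.
  have : measurable_fun setT (fun x => `|h n x - f x|)%R.
    by apply: measurableT_comp => //; exact: measurable_funB.
  by apply => //; exact: measurable_itv.
have mE' n : measurable (\bigcup_(k in [set k | (n <= k)%N]) E k) by exact: bigcup_measurable.
have E0 : mu (lim_sup_set E) = 0.
  apply/negligibleP; first exact: bigcap_measurable.
  apply: negligibleS hf => x hx /= /cvgrPdist_lt/(_ e e0)[n _ hn].
  have [k /= nk] := hx n I; rewrite /E/= leNgt => /negP; apply.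
  by rewrite distrC; exact: hn.
have : mu (\bigcup_(k in [set k | (n <= k)%N]) E k) @[n --> \oo] --> 0.
  rewrite -E0; apply: lim_sup_set_cvg => //.
  by rewrite ltey_eq fin_num_measure.
move=> /fine_cvgP[_ /cvgrPdist_lt/(_ e e0)[n _ /(_ n (leqnn n))]] /=.
rewrite sub0r normrN => h1; exists n.
apply: (@le_lt_trans _ _ (mu (\bigcup_(k in [set k | (n <= k)%N]) E k))).
  by apply: le_measure; [rewrite inE; exact: mE|rewrite inE|move=> x ?; exists n => /=].
rewrite -[ltLHS]fineK ?fin_num_measure// lte_fin.
exact: le_lt_trans (ler_norm _) h1.
Qed.

Lemma density_gap (Q P : set T -> \bar R) f g (e delta : R) : (0 < e)%R ->
    measurable_fun setT f -> measurable_fun setT g ->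
    (forall x, (0 <= f x)%R) -> (forall x, (0 <= g x)%R) ->
    (forall B, measurable B -> Q B = \int[mu]_(x in B) (g x)%:E) ->
    (forall B, measurable B -> P B = \int[mu]_(x in B) (f x)%:E) ->
    (forall B, measurable B -> P B \is a fin_num) ->
    (forall B, measurable B -> Q B - P B <= delta%:E) ->
  mu [set x | (f x + e <= g x)%R] <= (delta / e)%:E.
Proof.
move=> e0 mf mg f0 g0 QE PE Pfin QP.
set B := [set x | _].
have mB : measurable B.
  rewrite -[B]setTI; apply: measurable_fun_le => //.
  by apply: measurable_funD.
rewrite EFinM -[leLHS]mul1e -(mulVf (lt0r_neq0 e0)) EFinM -muleA muleC.
apply: lee_wpmul2r; first by rewrite lee_fin invr_ge0 ltW.
apply: le_trans (QP _ mB); rewrite leeBrDr ?Pfin// QE// PE//.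
have -> : e%:E * mu B = \int[mu]_(x in B) e%:E by rewrite integral_cst.
rewrite -ge0_integralD//; last 3 first.
- by move=> x _; rewrite lee_fin ltW.
- by move=> x _; rewrite lee_fin.
- by apply/measurable_EFinP; exact: measurable_funTS.
apply: ge0_le_integral => //.
- by move=> x _; rewrite adde_ge0 ?lee_fin// ltW.
- by apply/measurable_EFinP; apply: measurable_funD => //; exact: measurable_funTS.
- by apply/measurable_EFinP; exact: measurable_funTS.
- by move=> x Bx; rewrite -EFinD lee_fin addrC.
Qed.

Lemma density_distance (Q P : set T -> \bar R) f g (e delta : R) : (0 < e)%R ->
    measurable_fun setT f -> measurable_fun setT g ->
    (forall x, (0 <= f x)%R) -> (forall x, (0 <= g x)%R) ->
    (forall B, measurable B -> Q B = \int[mu]_(x in B) (g x)%:E) ->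
    (forall B, measurable B -> P B = \int[mu]_(x in B) (f x)%:E) ->
    (forall B, measurable B -> Q B \is a fin_num) ->
    (forall B, measurable B -> P B \is a fin_num) ->
    (forall B, measurable B -> `|Q B - P B| <= delta%:E) ->
  mu [set x | (e <= `|g x - f x|)%R] <= (2 * delta / e)%:E.
Proof.
move=> e0 mf mg f0 g0 QE PE Qfin Pfin QP.
have m1 : measurable [set x | (f x + e <= g x)%R].
  by rewrite -[X in measurable X]setTI; apply: measurable_fun_le => //; exact: measurable_funD.
have m2 : measurable [set x | (g x + e <= f x)%R].
  by rewrite -[X in measurable X]setTI; apply: measurable_fun_le => //; exact: measurable_funD.
have -> : [set x | (e <= `|g x - f x|)%R] =
    [set x | (f x + e <= g x)%R] `|` [set x | (g x + e <= f x)%R].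
  apply/seteqP; split => x /=; rewrite ler_normr.
    by move=> /orP[|] h; [left|right]; lra.
  by move=> -[] h; apply/orP; [left|right]; lra.
apply: le_trans (measureU2 _ _ _) _ => //.
rewrite (_ : (2 * delta / e)%:E = (delta / e)%:E + (delta / e)%:E); last first.
  by rewrite -EFinD; congr EFin; rewrite -mulrA mulr_natl mulr2n.
apply: leeD.
  apply: (@density_gap Q P) => // B mB; apply: le_trans (QP _ mB); exact: lee_abs.
apply: (@density_gap P Q) => // B mB; apply: le_trans (QP _ mB).
rewrite -abseN fin_num_oppeB ?Qfin ?Pfin// addeC; exact: lee_abs.
Qed.

End convergence_in_measure.

Section variation.
Context d (T : measurableType d) (R : realType).
Implicit Types (Q P : probability T R).
Local Open Scope ereal_scope.

Lemma probability_null_setI P G B : measurable G ->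
  P (~` G) = 0 -> measurable B -> P B = P (B `&` G).
Proof.
move=> mG PG mB; have mBG : measurable (B `&` G) by exact: measurableI.
have nBG : P (B `\` G) = 0.
  apply/eqP; rewrite eq_le measure_ge0 andbT -PG.
  by apply: le_measure; rewrite ?inE; [exact: measurableD|exact: measurableC|move=> x []].
apply/eqP; rewrite eq_le; apply/andP; split; last first.
  by apply: le_measure; rewrite ?inE//; exact: subIsetl.
rewrite -[leRHS]adde0 -nBG -[in leLHS](setUIDK B G).
by apply: measureU2; [exact: measurableI|exact: measurableD].
Qed.

Lemma probability_setT_negligible P : ~ P.-negligible setT.
Proof.
move=> /(negligibleP _ measurableT) PT.
by have := @probability_setT _ _ _ P; rewrite PT => /eqP; rewrite eq_sym onee_eq0.
Qed.

Lemma le_variation_dist Q P B : measurable B -> `|Q B - P B| <= variation_dist Q P.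
Proof.
move=> mB; rewrite /variation_dist /total_variation_charge.
set h := (X in charge_variation X).
have := abse_charge_variation h mB; rewrite /cadd/copp/= => /le_trans; apply.
by apply: (@le_measure _ _ _ (charge_variation h)); rewrite ?inE.
Qed.

Lemma variation_dist_le Q P (e : R) :
  (forall B, measurable B -> `|Q B - P B| <= e%:E) -> variation_dist Q P <= (e + e)%:E.
Proof.
move=> h; rewrite /variation_dist /total_variation_charge.
set hd := (X in charge_variation X); have [posP negN _ _] := hd.
have [mP _] := posP; have [mN _] := negN.
rewrite /charge_variation EFinD; apply: leeD.
  rewrite jordan_posE cjordan_posE /crestr0 mem_set// /crestr/= setTI.
  apply: le_trans (h _ mP); exact: lee_abs.
rewrite jordan_negE cjordan_negE /crestr0 mem_set// /crestr/= setTI.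
by apply: le_trans (h _ mN); rewrite -abseN; exact: lee_abs.
Qed.

Lemma variation_dist_fin Q P : variation_dist Q P \is a fin_num.
Proof.
rewrite /variation_dist /total_variation_charge; exact: fin_num_measure.
Qed.

End variation.
(** * Limits of exponential densities *)

Section approximation.
Context (R : realType) (d : nat) (mu : {finite_measure set 'rV[R]_d -> \bar R}).
Implicit Types (u v x y theta : 'rV[R]_d) (A B F : set 'rV[R]_d) (V : 'M[R]_d).

Lemma affine_fun_measurable theta (c : R) : measurable_fun setT (fun x => dotv theta x + c).
Proof. by apply: measurable_funD => //; exact: dotv_measurable. Qed.

Lemma expR_affine_measurable theta (c : R) :
  measurable_fun setT (fun x => expR (dotv theta x + c)).
Proof. by apply: measurableT_comp => //; exact: affine_fun_measurable. Qed.

Lemma face_approximation F theta (c e : R) : is_face (convex_core mu) F -> 0 < e ->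
  exists theta' (c' : R), (mu [set x | (e <= `|expR (dotv theta' x + c') -
    \1_(closure F) x * expR (dotv theta x + c)|)%R] < e%:E)%E.
Proof.
move=> faceF e0; have [[x0 Fx0] _ _ _] := faceF.
have [u [uF udiv]] := face_divergent faceF Fx0.
pose h s x := expR (dotv (theta - u s) x + (c + dotv (u s) x0)).
pose f x := \1_(closure F) x * expR (dotv theta x + c).
have hE s x : h s x = expR (dotv theta x + c) * expR (- dotv (u s) (x - x0)).
  rewrite -expRD /h dotvDl dotvNl dotvDr dotvNr; congr expR; ring.
have [||||s hs] := @cvg_ae_measure _ _ _ mu h f e.
- by [].
- by move=> n; exact: expR_affine_measurable.
- apply: measurable_funM; last exact: expR_affine_measurable.
  by apply: measurable_indic; exact: measurable_closure_mx.
- apply: negligibleS (negligibleU udiv (face_closure faceF)) => x /= hx.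
  have [Ax|Ax] := pselect (affine_hull F x).
    right; split=> // clx; apply: hx.
    rewrite /f indicE mem_set// mul1r.
    rewrite (_ : (fun n => h n x) = cst (expR (dotv theta x + c))); first exact: cvg_cst.
    apply/funext => n; rewrite hE uF ?oppr0 ?expR0 ?mulr1//.
    by exists x => //; exists x0 => //; exact: sub_affine_hull.
  left=> -[//|/= ux]; apply: hx.
  rewrite /f indicE memNset ?mul0r//; last by move=> /closure_sub_affine_hull.
  under eq_fun do rewrite hE.
  have h0 := cvg_comp _ _ ux (@cvgr_expR R).
  by have := cvgM (cvg_cst (expR (dotv theta x + c))) h0; rewrite mulr0; exact.
by exists (theta - u s), (c + dotv (u s) x0).
Qed.

Lemma tilted_density A theta (Q : probability 'rV[R]_d R) : measurable A ->
  is_tilted mu A theta Q -> exists c : R, forall B, measurable B ->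
    (Q B = \int[mu]_(x in B) (\1_A x * expR (dotv theta x + c))%:E)%E.
Proof.
move=> mA QE; exists (- fine (log_laplace mu A theta)) => B mB.
rewrite QE// integral_mkcondr; apply: eq_integral => x _.
by rewrite patchE indicE; case: ifPn => _; rewrite ?mul1r ?mul0r.
Qed.

Lemma extension_approximation (Q : nat -> probability 'rV[R]_d R) (P : probability 'rV[R]_d R)
    (f : 'rV[R]_d -> R) (e : R) :
    (forall n, extension mu (Q n)) -> cvg_in_variation Q P ->
    measurable_fun setT f -> (forall x, 0 <= f x) ->
    (forall B, measurable B -> P B = \int[mu]_(x in B) (f x)%:E)%E -> 0 < e ->
  exists theta (c : R), (mu [set x | (e <= `|expR (dotv theta x + c) - f x|)%R] <= e%:E)%E.
Proof.
move=> extQ QP mf f0 PE e0.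
pose delta := e ^+ 2 / 8.
have d0 : 0 < delta by rewrite divr_gt0// exprn_gt0.
have [n Qn] : exists n, (variation_dist (Q n) P <= delta%:E)%E.
  move/fine_cvgP : QP => [_ /cvgrPdist_lt/(_ _ d0)[n _ /(_ n (leqnn n))]] /=.
  rewrite sub0r normrN => h; exists n.
  rewrite -[leLHS]fineK ?variation_dist_fin// lee_fin.
  by rewrite (le_trans (ler_norm _))// ltW.
have [F faceF [theta [_ _] tQ]] := extQ n.
have mF := measurable_closure_mx F.
have [c QE] := tilted_density mF tQ.
pose g x := \1_(closure F) x * expR (dotv theta x + c).
have mg : measurable_fun setT g.
  by apply: measurable_funM; [exact: measurable_indic|exact: expR_affine_measurable].
have e20 : 0 < e / 2 by rewrite divr_gt0.
have h1 : (mu [set x | (e / 2 <= `|g x - f x|)%R] <= (2 * delta / (e / 2))%:E)%E.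
  apply: (@density_distance _ _ _ mu (Q n) P) => //.
  - by move=> x; rewrite mulr_ge0 ?expR_ge0// indicE ler0n.
  - by move=> B mB; rewrite fin_num_measure.
  - by move=> B mB; rewrite fin_num_measure.
  - by move=> B mB; apply: le_trans (le_variation_dist _ _ mB) Qn.
have [theta' [c' h2]] := face_approximation theta c faceF e20.
exists theta', c'.
have me (a b : 'rV[R]_d -> R) (r : R) : measurable_fun setT a -> measurable_fun setT b ->
    measurable [set x | r <= `|a x - b x|].
  move=> ma mb; rewrite -[X in measurable X]setTI; apply: measurable_fun_le => //.
  by apply: measurableT_comp => //; exact: measurable_funB.
apply: (@le_trans _ _ (mu ([set x | (e / 2 <= `|expR (dotv theta' x + c') - g x|)%R] `|`
    [set x | (e / 2 <= `|g x - f x|)%R]))).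
  apply: le_measure; rewrite ?inE.
  - by apply: me => //; exact: expR_affine_measurable.
  - by apply: measurableU; apply: me => //; exact: expR_affine_measurable.
  - move=> x /= ex; apply: contrapT => /not_orP[/= /negP + /negP]; rewrite -!ltNge => l1 l2.
    have : e < e / 2 + e / 2; last by lra.
    apply: le_lt_trans ex _; apply: le_lt_trans (ltrD l1 l2).
    by rewrite (le_trans _ (ler_normD _ _))// addrA subrK.
apply: le_trans (measureU2 _ _ _) _.
- by apply: me => //; exact: expR_affine_measurable.
- exact: me.
rewrite (_ : e%:E = (e / 2)%:E + (e / 2)%:E)%E; last by rewrite -EFinD; congr EFin; lra.
apply: leeD; first exact: ltW.
apply: le_trans h1 _; rewrite lee_fin /delta le_eqVlt; apply/orP; left; apply/eqP.
by field; rewrite gt_eqF.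
Qed.

Lemma extension_limit (Q : nat -> probability 'rV[R]_d R) (P : probability 'rV[R]_d R)
    (f : 'rV[R]_d -> R) :
    (forall n, extension mu (Q n)) -> cvg_in_variation Q P ->
    measurable_fun setT f -> (forall x, 0 <= f x) ->
    (forall B, measurable B -> P B = \int[mu]_(x in B) (f x)%:E)%E ->
  exists (theta_ : nat -> 'rV[R]_d) (c : nat -> R), mu.-negligible
    [set x | ~ (expR (dotv (theta_ k) x + c k) @[k --> \oo] --> f x)].
Proof.
move=> extQ QP mf f0 PE.
have h k : exists tc : 'rV[R]_d * R, (mu [set x | (2 ^- k.+1 <=
    `|expR (dotv tc.1 x + tc.2) - f x|)%R] <= (2 ^- k.+1)%:E)%E.
  have e0 : 0 < 2 ^- k.+1 :> R by rewrite invr_gt0 exprn_gt0.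
  have [theta [c tcP]] := extension_approximation extQ QP mf f0 PE e0.
  by exists (theta, c).
have [tc tcP] := choice h.
exists (fun k => (tc k).1), (fun k => (tc k).2).
pose E k := [set x | 2 ^- k.+1 <= `|expR (dotv (tc k).1 x + (tc k).2) - f x|].
have mE k : measurable (E k).
  rewrite -[E k]setTI; apply: measurable_fun_le => //.
  apply: measurableT_comp => //; apply: measurable_funB => //.
  exact: expR_affine_measurable.
have E0 := borel_cantelli_half mE tcP.
have : mu.-negligible (lim_sup_set E).
  by apply/negligibleP => //; apply: bigcap_measurable => // n _; exact: bigcup_measurable.
apply: negligibleS => x /= nx n _; apply: contrapT => nE; apply: nx.
apply/cvgrPdist_lt => e e0.
have h2 : 2 ^- k.+1 @[k --> \oo] --> (0 : R).
  rewrite (_ : (fun k => _) = fun k => 2^-1 * 2^-1 ^+ k); last first.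
    by apply/funext => k; rewrite -exprVn exprS.
  have h0 : 2^-1 ^+ k @[k --> \oo] --> (0 : R).
    by apply: cvg_expr; rewrite ger0_norm// invf_lt1// ltr1n.
  by have := cvgM (cvg_cst (2^-1 : R)) h0; rewrite mulr0; exact.
move/cvgrPdist_lt : h2 => /(_ e e0)[m _ hm].
exists (maxn n m) => // k /=; rewrite geq_max => /andP[nk mk].
have := hm k mk; rewrite /= sub0r normrN => /(le_lt_trans (ler_norm _)); apply: lt_trans.
rewrite distrC ltNge; apply/negP => Ek; apply: nE; exists k => //.
Qed.

End approximation.
Section affine_limits.
Context (R : realType) (d : nat).
Implicit Types (u v x y theta : 'rV[R]_d) (A B F : set 'rV[R]_d) (V : 'M[R]_d).

Lemma expR_cvg0_cvgNy (h : nat -> R) : expR (h k) @[k --> \oo] --> 0 ->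
  h k @[k --> \oo] --> -oo.
Proof.
move=> h0; apply/cvgrNyPle => M.
move/cvgrPdist_lt : h0 => /(_ _ (expR_gt0 M)); apply: filterS => k.
by rewrite sub0r normrN ger0_norm ?expR_ge0// ltr_expR => /ltW.
Qed.

(* Otherwise, by Borel-Cantelli, almost every point lies eventually in each of a
   sequence of affine sets that do not contain the support; the set of these
   points is affine, and finitely many points generate the support. *)
Lemma affine_support_stable (P : probability 'rV[R]_d R) x0 V :
    (forall B, affine_set B -> P.-negligible (~` B) -> flat x0 V `<=` B) ->
  exists2 e : R, 0 < e &
    forall B, affine_set B -> (P (~` B) <= e%:E)%E -> flat x0 V `<=` B.
Proof.
move=> minV; apply: contrapT => nstable.
have h (j : nat) : exists B, [/\ affine_set B, (P (~` B) <= (2 ^- j.+1)%:E)%E &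
    ~ (flat x0 V `<=` B)].
  apply: contrapT => hB; apply: nstable; exists (2 ^- j.+1).
    by rewrite invr_gt0 exprn_gt0.
  by move=> B affB PB; apply: contrapT => nB; apply: hB; exists B.
have [B BP] := choice h.
have affB j : affine_set (B j) by have [] := BP j.
have mB j : measurable (~` (B j)) by apply: measurableC; exact: affine_measurable.
have lim0 : P (lim_sup_set (fun j => ~` (B j))) = 0%E.
  by apply: borel_cantelli_half => // j; have [] := BP j.
pose L := [set x | exists N, forall j, (N <= j)%N -> B j x].
have affL : affine_set L.
  move=> t x y [N xN] [M yM]; exists (maxn N M) => j.
  by rewrite geq_max => /andP[Nj Mj]; apply: affB; [exact: xN|exact: yM].
have AL : flat x0 V `<=` L.
  apply: minV => //.
  have : P.-negligible (lim_sup_set (fun j => ~` (B j))).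
    by apply/negligibleP => //; apply: bigcap_measurable => // n _; exact: bigcup_measurable.
  apply: negligibleS => x /= nL n _; apply: contrapT => nB; apply: nL.
  by exists n => j nj; apply: contrapT => nBj; apply: nB; exists j.
have [N0 x0N] := AL _ (flat_refl x0 V).
have rowA i : flat x0 V (x0 + row i V) by rewrite flat_addr row_sub.
have [N NP] := choice (fun i => AL _ (rowA i)).
pose M := maxn N0 (\max_i N i).
have [_ _] := BP M; apply.
have Bx0 : B M x0 by apply: x0N; exact: leq_maxl.
have [W BW] := affine_setP (affB M) Bx0.
have VW : (V <= W)%MS.
  apply/row_subP => i; have : B M (x0 + row i V).
    by apply: NP; rewrite /M leq_max (leq_bigmax i) orbT.
  by rewrite BW flat_addr.
by move=> x; rewrite BW /flat/= => /submx_trans; apply.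
Qed.

Lemma affine_limit (theta_ : nat -> 'rV[R]_d) (c_ : nat -> R) x0 V :
    (forall x, flat x0 V x -> exists l : R, dotv (theta_ k) x + c_ k @[k --> \oo] --> l) ->
  exists theta (c : R),
    forall x, flat x0 V x -> dotv (theta_ k) x + c_ k @[k --> \oo] --> dotv theta x + c.
Proof.
move=> lims; have [p [pV pE]] := orthogonal_projection V.
have [l0 hl0] := lims _ (flat_refl x0 V).
have pK v : (v <= V)%MS -> v *m p = v.
  move=> vV; apply/eqP; rewrite -subr_eq0; apply/eqP/dotv_eq0.
  rewrite {1}dotvDl dotvNl pE ?subrr//.
  by rewrite addmx_sub// eqmx_opp.
have linlim v : (v <= V)%MS -> exists l : R, dotv (theta_ k) v @[k --> \oo] --> l.
  move=> vV; have [|l hl] := lims (x0 + v); first by rewrite flat_addr.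
  exists (l - l0).
  rewrite (_ : (fun k => _) =
      fun k => dotv (theta_ k) (x0 + v) + c_ k - (dotv (theta_ k) x0 + c_ k)); first exact: cvgB.
  by apply/funext => k; rewrite dotvDr; ring.
pose e i : 'rV[R]_d := delta_mx ord0 i.
have [t tP] := choice (fun i => linlim _ (pV (e i))).
pose theta : 'rV[R]_d := \row_i t i.
have thetaP v : (v <= V)%MS -> dotv (theta_ k) v @[k --> \oo] --> dotv theta v.
  move=> vV.
  rewrite (_ : (fun k => _) = fun k => \sum_i dotv (theta_ k) (e i *m p) * v ord0 i); last first.
    apply/funext => k; rewrite -{1}(pK v vV) {1}(row_sum_delta v) mulmx_suml.
    rewrite dotvE linear_sum/= mulmx_sumr summxE.
    by apply: eq_bigr => i _; rewrite -dotvE -scalemxAl dotvZr mulrC.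
  rewrite (_ : dotv theta v = \sum_i t i * v ord0 i); last first.
    by apply: eq_bigr => i _; rewrite mxE.
  apply: (@cvg_big R 'I_d +%R 0 xpredT) => [|i _].
    by move=> x; apply: cvgD; [exact: cvg_fst|exact: cvg_snd].
  exact: (cvgM (tP i) (cvg_cst (v ord0 i))).
exists theta, (l0 - dotv theta x0) => x xA.
rewrite (_ : (fun k => _) = fun k => dotv (theta_ k) (x - x0) + (dotv (theta_ k) x0 + c_ k)); last first.
  by apply/funext => k; rewrite dotvDr dotvNr; ring.
rewrite (_ : dotv theta x + _ = dotv theta (x - x0) + l0); last by rewrite dotvDr dotvNr; ring.
by apply: cvgD => //; exact: thetaP.
Qed.

End affine_limits.

Section components.
Context (R : realType) (d : nat) (mu : {finite_measure set 'rV[R]_d -> \bar R}).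
Implicit Types (u v x y theta : 'rV[R]_d) (A B F : set 'rV[R]_d) (V : 'M[R]_d).

Lemma tilted_component F x0 V theta (c : R) (Q : probability 'rV[R]_d R) :
    affine_hull F = flat x0 V ->
    (forall B, measurable B ->
       Q B = \int[mu]_(x in B `&` closure F) (expR (dotv theta x + c))%:E)%E ->
  component mu F Q.
Proof.
move=> FV QE; have [p [pV pE]] := orthogonal_projection V.
pose th := theta *m p; pose c' := dotv theta x0 - dotv th x0 + c.
have mF := measurable_closure_mx F.
have mexp t D : measurable D -> measurable_fun D (fun x => (expR (dotv t x))%:E : \bar R).
  move=> mD; apply/measurable_EFinP; apply: measurable_funTS.
  by apply: measurableT_comp => //; exact: dotv_measurable.
have QE' B : measurable B ->
    (Q B = \int[mu]_(x in B `&` closure F) (expR (dotv th x + c'))%:E)%E.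
  move=> mB; rewrite QE//; apply: eq_integral => x; rewrite inE => -[_ Fx].
  congr (expR _)%:E.
  have : dotv th (x - x0) = dotv theta (x - x0).
    by apply: pE; have := closure_sub_affine_hull Fx; rewrite FV.
  by rewrite !dotvDr !dotvNr /c'; lra.
have split B : measurable B -> (Q B =
    (\int[mu]_(x in B `&` closure F) (expR (dotv th x))%:E) * (expR c')%:E)%E.
  move=> mB; rewrite QE'//; under eq_integral do rewrite expRD EFinM.
  rewrite ge0_integralZr//.
  - exact: measurableI.
  - by apply: mexp; exact: measurableI.
have I1 : (\int[mu]_(x in closure F) (expR (dotv th x))%:E = (expR (- c'))%:E)%E.
  have := split _ measurableT; rewrite probability_setT setTI => h.
  rewrite -[LHS]mule1 -[in LHS](expR0) -(subrr c') addrC expRD EFinM.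
  by rewrite muleA -muleAC -h mul1e.
have LE : log_laplace mu (closure F) th = (- c')%:E.
  by rewrite /log_laplace I1 lne_EFin ?expR_gt0// expRK.
exists th; first split.
- by rewrite /dom_log_laplace/= LE ltry.
- by rewrite (lin_flat FV)/=; exact: pV.
- by move=> B mB; rewrite QE'// LE/= opprK.
Qed.

End components.
Section limit_density.
Context (R : realType) (d : nat) (mu : {finite_measure set 'rV[R]_d -> \bar R}).
Context (Q : nat -> probability 'rV[R]_d R) (P : probability 'rV[R]_d R).
Context (extQ : forall n, extension mu (Q n)) (QP : cvg_in_variation Q P).

Lemma variation_cvg_near (e : R) : 0 < e ->
  \forall n \near \oo, (variation_dist (Q n) P <= e%:E)%E.
Proof.
move=> e0; move/fine_cvgP : QP => [_ /cvgrPdist_lt/(_ _ e0)]; apply: filterS => n /=.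
rewrite sub0r normrN => h; rewrite -[leLHS]fineK ?variation_dist_fin// lee_fin.
by rewrite (le_trans (ler_norm _))// ltW.
Qed.

Lemma limit_dominated B : measurable B -> mu B = 0%E -> P B = 0%E.
Proof.
move=> mB muB.
have Q0 n : Q n B = 0%E.
  have [F faceF [theta [_ _] tQ]] := extQ n.
  have [c ->//] := tilted_density (measurable_closure_mx F) tQ.
  apply: null_set_integral => //.
  apply/measurable_EFinP; apply: measurable_funTS; apply: measurable_funM.
    by apply: measurable_indic; exact: measurable_closure_mx.
  exact: expR_affine_measurable.
apply/eqP; rewrite eq_le measure_ge0 andbT; apply/lee_addgt0Pr => e e0; rewrite add0e.
have [n _ /(_ n (leqnn n))] := variation_cvg_near e0.
apply: le_trans; apply: le_trans (le_variation_dist (Q n) P mB).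
by rewrite Q0 sub0e abseN gee0_abs.
Qed.

Lemma limit_negligible (B : set 'rV[R]_d) : mu.-negligible B -> P.-negligible B.
Proof. by move=> [N [mN N0 BN]]; exists N; split=> //; exact: limit_dominated. Qed.

Lemma limit_density : exists f : 'rV[R]_d -> R,
  [/\ measurable_fun setT f, forall x, 0 <= f x &
      forall B, measurable B -> (P B = \int[mu]_(x in B) (f x)%:E)%E].
Proof.
have PmuP : P `<< mu by apply/null_content_dominatesP; exact: limit_dominated.
have [f [f0 ffin intf PE]] := radon_nikodym_sigma_finite PmuP.
exists (fine \o f); split.
- apply: measurableT_comp => //; exact: measurable_int intf.
- by move=> x; exact/fine_ge0.
- by move=> B mB; rewrite PE//; apply: eq_integral => x _ /=; rewrite fineK.
Qed.

Lemma limit_face : exists x0 V theta (c : R), let A := flat x0 V in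
  [/\ P.-negligible (~` A),
      forall B, affine_set B -> P.-negligible (~` B) -> A `<=` B,
      is_face (convex_core mu) (convex_core mu `&` A) &
      forall B, measurable B ->
        (P B = \int[mu]_(x in B `&` A) (expR (dotv theta x + c))%:E)%E].
Proof.
have [f [mf f0 PE]] := limit_density.
have [theta_ [c_ fP]] := extension_limit extQ QP mf f0 PE.
pose a k x := dotv (theta_ k) x + c_ k.
have aE k t x y : a k (t *: x + (1 - t) *: y) = t * a k x + (1 - t) * a k y.
  by rewrite /a dotvDr !dotvZr; ring.
have [||||x0 [V [PA minA]]] := @affine_support R d P.-negligible.
- by move=> A B AB; exact: negligibleS.
- exact: negligibleU.
- exact: negligible_set0.
- exact: probability_setT_negligible.
set A := flat x0 V in PA minA.
have mA : measurable A by apply: closed_measurable_mx; exact: closed_flat.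
pose L := [set x | exists l : R, a k x @[k --> \oo] --> l].
have affL : affine_set L.
  move=> t x y [lx hx] [ly hy]; exists (t * lx + (1 - t) * ly).
  under eq_fun do rewrite aE.
  by apply: cvgD; [exact: (cvgM (cvg_cst t) hx)|exact: (cvgM (cvg_cst (1 - t)) hy)].
have P0 : P.-negligible [set x | f x <= 0].
  have m0 : measurable [set x | f x <= 0].
    by rewrite -[X in measurable X]setTI; apply: measurable_fun_le.
  apply/(negligibleP _ m0); apply: etrans (PE _ m0) _; apply: integral0_eq => x /= fx.
  by congr EFin; apply/eqP; rewrite eq_le fx f0.
have AL : A `<=` L.
  apply: minA => //; apply: negligibleS (negligibleU P0 (limit_negligible fP)) => x /= nL.
  have [fx|fx] := leP (f x) 0; first by left.
  right=> /= cvf; apply: nL; exists (ln (f x)).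
  rewrite (_ : (fun k => _) = fun k => ln (expR (a k x))); last first.
    by apply/funext => k; rewrite expRK.
  exact: (cvg_comp _ _ cvf (continuous_ln fx)).
have [theta [c acvg]] := affine_limit AL.
have f0A : mu.-negligible (~` A `&` [set x | f x <> 0]).
  have mE : measurable_fun (~` A) (EFin \o f).
    by apply/measurable_EFinP; exact: measurable_funTS.
  have /ae_eq_integral_abs : (\int[mu]_(x in ~` A) `|(EFin \o f) x| = 0)%E.
    rewrite (_ : (\int[mu]_(x in _) _)%E = (\int[mu]_(x in ~` A) (f x)%:E)%E); last first.
      by apply: eq_integral => x _ /=; rewrite ger0_norm.
    by rewrite -PE; [apply/negligibleP => //|]; exact: measurableC.
  move=> /(_ (measurableC mA) mE); apply: negligibleS => x [Ax fx] /= /(_ Ax) [].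
  exact: fx.
pose N := A `|` [set x | a k x @[k --> \oo] --> -oo].
have mN : measurable N.
  by apply: measurableU => //; apply: measurable_cvgNy => k; exact: affine_fun_measurable.
have cNN t x y : 0 < t < 1 -> a k x @[k --> \oo] --> -oo -> N y ->
    a k (t *: x + (1 - t) *: y) @[k --> \oo] --> -oo.
  move=> t01 xN yN; under eq_fun do rewrite aE.
  have [M yM] : exists M, \forall k \near \oo, a k y <= M.
    case: yN => [/acvg/cvg_bounded_above h|/= /cvgNy_bounded h]; [|by exists 0].
    by exists (dotv theta y + c + 1).
  exact: cvgNy_convex t01 xN yM.
have conv_swap (t : R) (x y : 'rV[R]_d) : t *: x + (1 - t) *: y = (1 - t) *: y + (1 - (1 - t)) *: x.
  by rewrite addrC subKr.
have swap01 (t : R) : 0 < t < 1 -> 0 < 1 - t < 1.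
  by move=> /andP[t0 t1]; rewrite subr_gt0 t1 gtrBl t0.
have cN : convex_set N.
  apply/convex_setP => t x y Nx Ny t01.
  case: (Nx) => [Ax|/= xN]; last by right; exact: cNN.
  case: (Ny) => [Ay|/= yN]; first by left; exact: affine_flat.
  by right; rewrite /= conv_swap; apply: cNN => //; exact: swap01.
have Nfull : mu N = mu setT.
  apply/eqP; rewrite eq_le le_measure ?inE//=.
  have nN : mu (~` N) = 0%E.
    apply/negligibleP; first exact: measurableC.
    apply: negligibleS (negligibleU fP f0A) => x /= /not_orP[Ax /= nx].
    have [fx|fx] := pselect (f x = 0); last by right.
    left=> cvf; apply: nx; apply: expR_cvg0_cvgNy; by rewrite -fx.
  rewrite -[leRHS]adde0 -nN -[in leLHS](setUv N).
  by apply: measureU2 => //; exact: measurableC.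
have CN : convex_core mu `<=` N by move=> x; apply.
have notA x y (t : R) : 0 < t < 1 -> N x -> N y -> A (t *: x + (1 - t) *: y) -> A x.
  move=> t01 [//|/= xN] Ny Az; exfalso.
  have /cvgrNyPle/(_ (dotv theta (t *: x + (1 - t) *: y) + c - 1))[n _ hn] := cNN _ _ _ t01 xN Ny.
  have /cvgrPdist_lt/(_ 1 ltr01)[m _ hm] := acvg _ Az.
  have h1 := hn (maxn n m) (leq_maxl _ _); have h2 := hm (maxn n m) (leq_maxr _ _).
  by move: h1 h2; rewrite /= -/(a _ _) ltr_norml; lra.
have muA : mu A <> 0%E.
  move=> /(limit_dominated mA) PA0.
  have : P.-negligible (A `|` ~` A) by apply: negligibleU => //; exact/negligibleP.
  by rewrite setUv; exact: probability_setT_negligible.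
exists x0, V, theta, c => /=; split=> //.
- split.
  + by apply: convex_core_meets => //; apply: affine_convex; exact: affine_flat.
  + apply/convex_setP => t x y [Cx Ax] [Cy Ay] t01; split; last exact: affine_flat.
    by move/convex_setP : (@convex_convex_core _ _ mu); apply.
  + by move=> x [].
  + move=> t x y Cx Cy t01 [_ Az]; have [Nx Ny] := (CN _ Cx, CN _ Cy).
    split; split=> //; first exact: notA t01 Nx Ny Az.
    by apply: notA (swap01 _ t01) Ny Nx _; rewrite -conv_swap.
- move=> B mB.
  have PA0 : P (~` A) = 0%E by apply/negligibleP => //; exact: measurableC.
  rewrite (probability_null_setI mA PA0 mB).
  have mBA : measurable (B `&` A) by exact: measurableI.
  rewrite PE//; apply: ae_eq_integral => //.
  + by apply/measurable_EFinP; exact: measurable_funTS.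
  + by apply/measurable_EFinP; apply: measurable_funTS; exact: expR_affine_measurable.
  + apply: negligibleS fP => x /= /not_implyP[[_ Ax] ne] cvf; apply: ne; congr EFin.
    apply: (cvg_unique _ cvf) => //.
    exact: (cvg_comp _ _ (acvg _ Ax) (@continuous_expR R _)).
Qed.

End limit_density.
Section conditioning.
Context d (T : measurableType d) (R : realType).
Implicit Types (Q P : probability T R) (B G : set T).
Local Open Scope ereal_scope.

Lemma conditionedE Q G (mG : measurable G) (q : R) : (0 < q)%R -> Q G = q%:E ->
  forall B, conditioned Q mG B = Q (B `&` G) * (q^-1)%:E.
Proof.
move=> q0 QG B; rewrite /conditioned/= /mnormalize.
have mass : mrestr Q mG setT = q%:E by rewrite /mrestr setTI.
case: ifPn => [/orP[]/eqP|_].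
- by rewrite [LHS]mass => -[] q00; move: q0; rewrite q00 ltxx.
- by rewrite [LHS]mass.
- exact: (congr1 (fun z => Q (B `&` G) * ((fine z)^-1)%:E) mass).
Qed.

Lemma variation_dist_ge0 Q P : 0 <= variation_dist Q P.
Proof. exact: le_trans (abse_ge0 _) (le_variation_dist Q P measurableT). Qed.

Lemma variation_dist_conditioned Q P G (mG : measurable G) (e : R) :
    P (~` G) = 0 -> (e < 1)%R -> variation_dist Q P <= e%:E ->
  variation_dist (conditioned Q mG) P <= (4 * e)%:E.
Proof.
move=> PG e1 QP.
have QPB B : measurable B -> `|Q B - P B| <= e%:E.
  by move=> mB; apply: le_trans (le_variation_dist Q P mB) QP.
have fin (P' : probability T R) B : measurable B -> P' B = (fine (P' B))%:E.
  by move=> mB; rewrite fineK// fin_num_measure.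
have PBG B : measurable B -> P B = P (B `&` G) by move=> mB; exact: probability_null_setI.
have PG1 : P G = 1 by rewrite -(setTI G) -PBG ?probability_setT.
pose q := fine (Q G).
have QG : Q G = q%:E by exact: fin.
have q1 : (`|q - 1| <= e)%R.
  by have := QPB _ mG; rewrite QG PG1 -EFinB lee_fin.
have q0 : (0 < q)%R by move: q1; rewrite ler_norml; lra.
have qle1 : (q <= 1)%R by rewrite -lee_fin -QG; exact: probability_le1.
rewrite (_ : 4 * e = 2 * e + 2 * e)%R; last by ring.
apply: variation_dist_le => B mB.
have mBG : measurable (B `&` G) by exact: measurableI.
rewrite (conditionedE mG q0 QG) PBG//; have := QPB _ mBG.
have QE := fin Q _ mBG; have := fin P _ mBG; move: QE.
set r := fine (Q _); set s := fine (P _) => QE ->; rewrite QE -EFinM -!EFinB !lee_fin.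
have r0 : (0 <= r)%R by apply: fine_ge0.
have rq : (r <= q)%R.
  by rewrite -lee_fin -QE -QG; apply: le_measure; rewrite ?inE//; exact: subIsetr.
have : (r * q^-1 <= 1)%R by rewrite ler_pdivrMr// mul1r.
have : (r * q^-1 - r = (r * q^-1) * (1 - q))%R by field; rewrite gt_eqF.
have : (0 <= r * q^-1)%R by rewrite divr_ge0// ltW.
set z := (r * q^-1)%R => z0 zE z1.
have : (0 <= z * (1 - q))%R by rewrite mulr_ge0// subr_ge0.
have : (z * (1 - q) <= 1 - q)%R by rewrite ler_piMl// subr_ge0.
move: q1; rewrite !ler_norml; lra.
Qed.

End conditioning.

Unset Implicit Arguments.

Theorem theorem4 (R : realType) (d : nat)
    (mu : {finite_measure set 'rV[R]_d -> \bar R})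
    (mu_neq0 : mu setT <> 0%E)
    (Q : nat -> probability 'rV[R]_d R) (P : probability 'rV[R]_d R)
    (extQ : forall n, extension mu (Q n))
    (QP : cvg_in_variation Q P) :
  exists F : set 'rV[R]_d,
    [/\ is_face (convex_core mu) F,
        component mu F P,
        \forall n \near \oo,
          (forall Fn : set 'rV[R]_d, is_face (convex_core mu) Fn ->
             component mu Fn (Q n) -> F `<=` Fn) /\
          (Q n (closure F) <> 0%E /\
           component mu F (conditioned (Q n) (measurable_closure_mx F))) &
        cvg_in_variation
          (fun n => conditioned (Q n) (measurable_closure_mx F)) P].
Proof.
have [x0 [V [theta [c [PA minA faceF PE]]]]] := limit_face extQ QP.
set A := flat x0 V in PA minA faceF PE; set F := _ `&` A in faceF.
have affA : affine_set A by exact: affine_flat.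
have mA : measurable A by exact: affine_measurable.
have mF := measurable_closure_mx F.
have PnegA : P.-negligible (~` closure F).
  have := convex_core_closure mu (affine_convex affA) mA.
  move=> /(limit_negligible extQ QP) h; apply: negligibleS (negligibleU h PA) => x /= xF.
  by have [Ax|Ax] := pselect (A x); [left|right].
have PF : P (~` closure F) = 0%E by apply/negligibleP => //; exact: measurableC.
have PF1 : P (closure F) = 1%E.
  by rewrite -(setTI (closure F)) -(probability_null_setI mF PF)// probability_setT.
have hullF : affine_hull F = A.
  apply/seteqP; split; first by apply: affine_hull_sub => // x [].
  apply: minA; first exact: affine_affine_hull.
  by apply: negligibleS PnegA => x /= nx /closure_sub_affine_hull.
have clFA : closure F `<=` A by rewrite -hullF; exact: closure_sub_affine_hull.
have PE' B : measurable B ->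
    (P B = \int[mu]_(x in B `&` closure F) (expR (dotv theta x + c))%:E)%E.
  move=> mB; rewrite (probability_null_setI mF PF mB) PE; last exact: measurableI.
  by rewrite -setIA (setIidl clFA).
have [e e0 eA] := affine_support_stable minA.
exists F; split=> //.
- exact: tilted_component hullF PE'.
- have min0 : 0 < Num.min e (1 / 2) by rewrite lt_min e0 divr_gt0.
  apply: filterS (variation_cvg_near QP min0) => n Qn.
  have Fsub Fn : is_face (convex_core mu) Fn -> component mu Fn (Q n) -> F `<=` Fn.
    move=> faceFn [th [_ _] tQ].
    have mFn := measurable_closure_mx Fn.
    have affFn := @affine_affine_hull _ _ Fn.
    have mhull : measurable (~` affine_hull Fn) by apply: measurableC; exact: affine_measurable.
    have Qhull : Q n (~` affine_hull Fn) = 0%E.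
      rewrite tQ// (_ : _ `&` _ = set0) ?integral_set0//.
      by apply/seteqP; split=> x // [nx /closure_sub_affine_hull].
    have : A `<=` affine_hull Fn.
      apply: eA => //; have := le_variation_dist (Q n) P mhull.
      rewrite Qhull sub0e abseN gee0_abs// => /le_trans; apply.
      by apply: le_trans Qn _; rewrite lee_fin ge_min lexx.
    by move=> AFn x [Cx Ax]; rewrite -(face_affine_hull faceFn); split=> //; exact: AFn.
  split=> //.
  have [q q0 QF] : exists2 q : R, 0 < q & Q n (closure F) = q%:E.
    have QFE : Q n (closure F) = (fine (Q n (closure F)))%:E.
      by rewrite fineK// fin_num_measure.
    exists (fine (Q n (closure F))) => //.
    have := le_trans (le_variation_dist (Q n) P mF) Qn.
    rewrite QFE PF1 -EFinB lee_fin ler_norml.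
    have : Num.min e (1 / 2) <= 1 / 2 by rewrite ge_min lexx orbT.
    lra.
  split; first by rewrite QF => -[] q00; move: q0; rewrite q00 ltxx.
  have [Fn faceFn cFn] := extQ n; have FFn := Fsub _ faceFn cFn.
  have [th [_ _] tQ] := cFn.
  have FFn' : closure F `<=` closure Fn by exact: closure_subset.
  apply: (@tilted_component _ _ mu F x0 V th (- fine (log_laplace mu (closure Fn) th) - ln q)) => //.
  move=> B mB.
  rewrite (conditionedE (measurable_closure_mx F) q0 QF) tQ; last exact: measurableI.
  rewrite -setIA (setIidl FFn').
  under [RHS]eq_integral do rewrite addrA expRD EFinM expRN lnK ?posrE//.
  rewrite ge0_integralZr//.
  + exact: measurableI.
  + apply/measurable_EFinP; apply: measurable_funTS; exact: expR_affine_measurable.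
  + by rewrite lee_fin invr_ge0 ltW.
- rewrite /cvg_in_variation.
  apply/fine_cvgP; split; first by apply: nearW => n; exact: variation_dist_fin.
  apply/cvgrPdist_lt => e' e'0.
  have d0 : 0 < Num.min (e' / 8) (1 / 2) by rewrite lt_min !divr_gt0.
  apply: filterS (variation_cvg_near QP d0) => n Qn /=.
  rewrite sub0r normrN ger0_norm; last by apply: fine_ge0; exact: variation_dist_ge0.
  set m := Num.min _ _ in Qn.
  have m1 : m < 1 by rewrite gt_min; apply/orP; right; lra.
  have me : m <= e' / 8 by rewrite ge_min lexx.
  rewrite -lte_fin fineK ?variation_dist_fin//.
  apply: le_lt_trans (variation_dist_conditioned (measurable_closure_mx F) PF m1 Qn) _.
  by rewrite lte_fin; move: me e'0; clear; lra.
Qed.
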